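(* Let $A$ be a unital semisimple commutative complex Banach algebra and $B$ a unital complex Banach algebra. Let $\mathfrak A$ be an open subgroup of $A^{-1}$ and $\mathfrak B$ an open subgroup of $B^{-1}$, and let $T:\mathfrak A\to\mathfrak B$ be a surjective isometry as a map between metric spaces (i.e. $\|T(f)-T(g)\|=\|f-g\|$ for all $f,g\in\mathfrak A$). Then $B$ is semisimple and commutative, and the map $f\mapsto T(1)^{-1}T(f)$ on $\mathfrak A$ extends to an isometric real algebra isomorphism from $A$ onto $B$ (a surjective real linear, multiplicative, norm-preserving bijection). In particular, $A^{-1}$ is isometrically isomorphic to $B^{-1}$ as a metrizable group.
   Context: $A^{-1}$ and $B^{-1}$ denote the groups of invertible elements of $A$ and $B$ with the metric induced by the norm; $1$ denotes the unit element. *)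

(* Defs.v *)
From Stdlib Require Import Reals.
Open Scope R_scope.

Record Cplx : Type := mkC { Cre : R ; Cim : R }.
Definition Cadd (a b : Cplx) : Cplx := mkC (Cre a + Cre b) (Cim a + Cim b).
Definition Cmul (a b : Cplx) : Cplx :=
  mkC (Cre a * Cre b - Cim a * Cim b) (Cre a * Cim b + Cim a * Cre b).
Definition C1 : Cplx := mkC 1 0.
Definition RtoC (r : R) : Cplx := mkC r 0.
Definition Cmod (a : Cplx) : R := sqrt (Cre a ^ 2 + Cim a ^ 2).

Record CBanachAlg : Type := {
  car :> Type;
  zero : car; one : car;
  add : car -> car -> car; opp : car -> car;
  mul : car -> car -> car; scal : Cplx -> car -> car;
  norm : car -> R;
  addA : forall x y z, add x (add y z) = add (add x y) z;
  addC : forall x y, add x y = add y x;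
  add0 : forall x, add zero x = x;
  addN : forall x, add x (opp x) = zero;
  scalDl : forall a b x, scal (Cadd a b) x = add (scal a x) (scal b x);
  scalDr : forall a x y, scal a (add x y) = add (scal a x) (scal a y);
  scalM : forall a b x, scal (Cmul a b) x = scal a (scal b x);
  scal1 : forall x, scal C1 x = x;
  mulA : forall x y z, mul x (mul y z) = mul (mul x y) z;
  mul1l : forall x, mul one x = x;
  mul1r : forall x, mul x one = x;
  mulDl : forall x y z, mul (add x y) z = add (mul x z) (mul y z);
  mulDr : forall x y z, mul x (add y z) = add (mul x y) (mul x z);
  scal_mull : forall a x y, scal a (mul x y) = mul (scal a x) y;
  scal_mulr : forall a x y, scal a (mul x y) = mul x (scal a y);
  norm_ge0 : forall x, 0 <= norm x;
  norm_eq0 : forall x, norm x = 0 -> x = zero;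
  norm_triangle : forall x y, norm (add x y) <= norm x + norm y;
  norm_scal : forall a x, norm (scal a x) = Cmod a * norm x;
  norm_mul : forall x y, norm (mul x y) <= norm x * norm y;
  norm_one : norm one = 1;
  complete : forall u : nat -> car,
    (forall eps, eps > 0 -> exists N, forall m n, (m >= N)%nat -> (n >= N)%nat ->
        norm (add (u m) (opp (u n))) < eps) ->
    exists l, forall eps, eps > 0 -> exists N, forall n, (n >= N)%nat ->
        norm (add (u n) (opp l)) < eps
}.

Arguments zero {c}. Arguments one {c}. Arguments add {c}. Arguments opp {c}.
Arguments mul {c}. Arguments scal {c}. Arguments norm {c}.

Section Notions.
Variable A : CBanachAlg.

Definition bdist (x y : A) : R := norm (add x (opp y)).

Definition invertible (x : A) : Prop :=
  exists y : A, mul x y = one /\ mul y x = one.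

Definition commutative : Prop := forall x y : A, mul x y = mul y x.

Definition left_ideal (I : A -> Prop) : Prop :=
  I zero /\ (forall x y, I x -> I y -> I (add x y)) /\
  (forall a x, I x -> I (mul a x)).

Definition maximal_left_ideal (I : A -> Prop) : Prop :=
  left_ideal I /\ ~ I one /\
  (forall J : A -> Prop, left_ideal J -> (forall x, I x -> J x) ->
     ~ J one -> forall x, J x -> I x).

Definition jacobson_radical (x : A) : Prop :=
  forall I, maximal_left_ideal I -> I x.

Definition semisimple : Prop := forall x, jacobson_radical x -> x = zero.

Definition open_set (U : A -> Prop) : Prop :=
  forall x, U x -> exists eps, eps > 0 /\ forall y, bdist y x < eps -> U y.

Definition open_subgroup_of_units (G : A -> Prop) : Prop :=
  (forall x, G x -> invertible x) /\ G one /\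
  (forall x y, G x -> G y -> G (mul x y)) /\
  (forall x y, G x -> mul x y = one -> mul y x = one -> G y) /\
  open_set G.

End Notions.

Arguments bdist {A}. Arguments invertible {A}. Arguments left_ideal {A}.
Arguments jacobson_radical {A}. Arguments open_set {A}.
Arguments open_subgroup_of_units {A}.

Definition isometric_real_algebra_iso (A B : CBanachAlg) (Phi : A -> B) : Prop :=
  (forall x y, Phi (add x y) = add (Phi x) (Phi y)) /\
  (forall (r : R) x, Phi (scal (RtoC r) x) = scal (RtoC r) (Phi x)) /\
  (forall x y, Phi (mul x y) = mul (Phi x) (Phi y)) /\
  (forall x, norm (Phi x) = norm x) /\
  (forall x y, Phi x = Phi y -> x = y) /\
  (forall z, exists x, Phi x = z).

(* Main.v *)
(* [T] maps midpoints to midpoints on small balls (Mazur-Ulam), so it is affine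
   along segments contained in the group.  Near the scalars it is [S + u], where
   [S] is a real-linear isometry; scaling towards [0] shows that the constant is
   [u] everywhere, and if [T] had linear part [S'] near [f], then
   [h = S^-1 (S' f - S f)] would satisfy [norm (1 - z h) = 1] for all small
   complex [z], which forces [h = 0].  So [T = S + u] on the whole group.  The
   group of [B] is invariant under translation by [u], hence that of [A] under
   translation by [S^-1 u]; this puts [S^-1 u] in the radical, and [u = 0].

   For a character [chi] of [A], the functional [chi o S^-1] is real-linear and
   does not vanish on the group of [B].  A real version of the
   Gleason-Kahane-Zelazko theorem writes it as [a eta + conj (k eta)] with [eta]
   a character of [B], and the isometry forces [a k = 0].  Hence
   [chi (S^-1 (x y)) chi (S^-1 1) = chi (S^-1 x) chi (S^-1 y)], and since
   characters separate the points of [A], [a |-> S (S^-1 1 * a)] is the required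
   isomorphism. *)
From Stdlib Require Import Reals.
From HB Require Import structures.
From mathcomp Require Import all_boot all_order all_algebra.
From mathcomp Require Import cyclic separable cyclotomic complex boolp.
From mathcomp Require Import classical_sets reals Rstruct ring lra zify.
From Coquelicot Require Compactness.
Require Import Defs.

Set Implicit Arguments.
Unset Strict Implicit.
Unset Printing Implicit Defensive.

Import Order.TTheory GRing.Theory Num.Theory Normc.
Local Open Scope ring_scope.
Local Open Scope complex_scope.

(** [T] is defined on a multiplicative group only, so every argument has to stay inside it. An open
    subgroup contains all nonzero scalars, because the punctured plane is connected and membership
    is locally constant along it. Hence it also contains the cone of all [m%:A + a] with
    [norm a < eps * normc m], and its elements can be scaled towards zero although zero is not among
    them. [B] is not known to be commutative, so its characters cannot be taken from maximal ideals;
    they are extracted from the functionals that characters of [A] induce on [B]. Polynomials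
    replace holomorphic functions: Cauchy estimates are averages over roots of unity, and the
    exponentials of the classical Gleason-Kahane-Zelazko argument become powers [(1 - z x)^n]. For
    small [z] these powers lie in the group, and a linear functional turns them into polynomials in
    [z] that can be factored. *)

Notation C := R[i].

(** * The complex algebra structure *)

Definition to_Cplx (z : C) : Cplx := mkC (complex.Re z) (complex.Im z).

HB.instance Definition _ (A : CBanachAlg) := gen_eqMixin A.
HB.instance Definition _ (A : CBanachAlg) := gen_choiceMixin A.

Section Instances.
Variable A : CBanachAlg.

Lemma add0l : left_id (@zero A) add.
Proof. exact: add0. Qed.

Lemma addNl : left_inverse (@zero A) opp add.
Proof. by move=> x; rewrite addC addN. Qed.

Lemma addCA : ssrfun.commutative (@add A).
Proof. exact: addC. Qed.
HB.instance Definition _ := GRing.isZmodule.Build (car A) (@addA A) addCA add0l addNl.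

Lemma Cmod_to_Cplx (z : C) : Cmod (to_Cplx z) = normc z.
Proof. by case: z => a b; rewrite /Cmod !RpowE RsqrtE. Qed.

Lemma one_neq_zero : @one A != 0.
Proof.
apply/eqP => e.
have := norm_scal A (to_Cplx 0) one; rewrite Cmod_to_Cplx normc0.
have -> : scal (to_Cplx 0) one = 0 :> A.
  apply: (addrI (scal (to_Cplx 0) (@one A))).
  rewrite addr0 -[LHS]/(add _ _) -scalDl; congr scal.
  by rewrite /Cadd /= !RplusE !addr0.
by rewrite -e norm_one RmultE mul0r => /eqP; rewrite oner_eq0.
Qed.

HB.instance Definition _ := GRing.Zmodule_isNzRing.Build (car A)
  (@Defs.mulA A) (@Defs.mul1l A) (@Defs.mul1r A) (@Defs.mulDl A) (@Defs.mulDr A)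
  one_neq_zero.

Definition cscale (z : C) (x : A) : A := scal (to_Cplx z) x.

Lemma cscaleA a b x : cscale a (cscale b x) = cscale (a * b) x.
Proof. by rewrite /cscale -scalM; case: a; case: b. Qed.

Lemma cscale1 : left_id 1 cscale.
Proof. exact: scal1. Qed.

Lemma cscaleDr : right_distributive cscale +%R.
Proof. by move=> a x y; exact: scalDr. Qed.

Lemma cscaleDl x : {morph cscale^~ x : a b / a + b}.
Proof. by move=> [a b] [c d]; rewrite /cscale -[RHS]/(add _ _) -scalDl. Qed.

HB.instance Definition _ := GRing.Zmodule_isLmodule.Build C (car A)
  cscaleA cscale1 cscaleDr cscaleDl.

Lemma cscaleAl (a : C) (x y : A) : a *: (x * y) = (a *: x) * y.
Proof. exact: scal_mull. Qed.

HB.instance Definition _ := GRing.Lmodule_isLalgebra.Build C (car A) cscaleAl.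

Lemma cscaleAr (a : C) (x y : A) : a *: (x * y) = x * (a *: y).
Proof. exact: scal_mulr. Qed.

HB.instance Definition _ := GRing.Lalgebra_isAlgebra.Build C (car A) cscaleAr.

Lemma normZ (a : C) (x : A) : norm (a *: x) = normc a * norm x.
Proof. by rewrite norm_scal Cmod_to_Cplx. Qed.

Lemma norm_ge0r (x : A) : 0 <= norm x.
Proof. exact/RleP/norm_ge0. Qed.

Lemma normD (x y : A) : norm (x + y) <= norm x + norm y.
Proof. exact/RleP/norm_triangle. Qed.

Lemma normM_le (x y : A) : norm (x * y) <= norm x * norm y.
Proof. exact/RleP/norm_mul. Qed.

Lemma norm1 : norm (1 : A) = 1.
Proof. exact: norm_one. Qed.

Lemma norm0 : norm (0 : A) = 0.
Proof. by rewrite -(scale0r (0 : A)) normZ normc0 mul0r. Qed.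

Lemma norm_eq0r (x : A) : norm x <= 0 -> x = 0.
Proof.
by move=> h; apply: norm_eq0; apply/eqP; rewrite eq_le h norm_ge0r.
Qed.

Lemma normc_real (r : R) : normc r%:C = `|r|.
Proof. by rewrite /= expr0n /= addr0 sqrtr_sqr. Qed.

Lemma normN (x : A) : norm (- x) = norm x.
Proof. by rewrite -scaleN1r normZ normcN normc1 mul1r. Qed.

Lemma normB (x y : A) : norm (x - y) = norm (y - x).
Proof. by rewrite -opprB normN. Qed.

Lemma normX_le (x : A) n : norm (x ^+ n) <= norm x ^+ n.
Proof.
elim: n => [|n IH]; first by rewrite !expr0 norm1.
rewrite !exprS; apply: le_trans (normM_le _ _) _.
by rewrite ler_wpM2l ?norm_ge0r.
Qed.

End Instances.

(** * Averages over roots of unity *)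

Lemma primitive_root_exists n : (0 < n)%N -> exists w : C, n.-primitive_root w.
Proof.
move=> n0; have [rs Drs] := closed_field_poly_normal ('X^n - 1 : {poly C}).
have lc : lead_coef ('X^n - 1 : {poly C}) = 1.
  by apply/eqP; rewrite -[_ == _]/(_ \is monic) monicXnsubC.
move: Drs; rewrite lc scale1r => Drs.
have sz : size rs = n.
  have := size_XnsubC (1 : C) n0; rewrite polyC1 Drs size_prod_XsubC.
  by move=> [].
have Urs : uniq rs.
  by rewrite -separable_prod_XsubC -Drs separable_Xn_sub_1 // pnatr_eq0 -lt0n.
suff /hasP[w _ pw] : has n.-primitive_root rs by exists w.
apply: has_prim_root => //; last by rewrite sz.
by apply/allP => w; rewrite -root_prod_XsubC -Drs.
Qed.

Lemma normc_ge0 (z : C) : 0 <= normc z.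
Proof. by case: z => a b; rewrite sqrtr_ge0. Qed.

Lemma normc_eq0 (z : C) : (normc z == 0) = (z == 0).
Proof.
by apply/eqP/eqP => [/eq0_normc|->] //; rewrite normc0.
Qed.

Lemma normcX (z : C) n : normc (z ^+ n) = normc z ^+ n.
Proof.
elim: n => [|n IH]; first by rewrite !expr0 normc1.
by rewrite !exprS normcM IH.
Qed.

Lemma normc_nat n : normc (n%:R : C) = n%:R.
Proof.
by rewrite -[n%:R : C](rmorph_nat (real_complex R)) normc_real ger0_norm.
Qed.

Lemma normc_unity n (w : C) : (0 < n)%N -> w ^+ n = 1 -> normc w = 1.
Proof.
move=> n0 e; have := normcX w n; rewrite e normc1 => /esym/eqP.
by rewrite pexpr_eq1 ?normc_ge0 // => /eqP.
Qed.

Lemma sum_unity_powers n (w : C) j : n.-primitive_root w -> (0 < j < n)%N ->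
  \sum_(k < n) (w ^+ k) ^+ j = 0.
Proof.
move=> pw /andP[j0 jn].
have wj : w ^+ j != 1.
  by apply/negP => /eqP/eqP; rewrite -(prim_order_dvd pw) gtnNdvd.
have := subrX1 (w ^+ j) n.
rewrite exprAC (prim_expr_order pw) expr1n subrr => /esym/eqP.
rewrite mulf_eq0 subr_eq0 (negPf wj) /= => /eqP E.
by rewrite -[RHS]E; apply: eq_bigr => k _; rewrite exprAC.
Qed.

Section Averages.
Variable (V : lmodType C).

(** A discrete Cauchy formula: orthogonality of the powers of [w] kills every coefficient of
    positive index, and there are as many nodes as coefficients, so no two exponents are
    confused. *)
Lemma average_const n (u : nat -> V) w (z : C) : n.+1.-primitive_root w ->
  \sum_(k < n.+1) \sum_(j < n.+1) (z * w ^+ k) ^+ j *: u j = n.+1%:R *: u 0.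
Proof.
move=> pw; rewrite exchange_big /= (bigD1 ord0) //= [X in _ + X]big1 ?addr0.
  by rewrite (eq_bigr (fun=> u 0)) ?sumr_const ?card_ord ?scaler_nat // => k _;
    rewrite expr0 scale1r.
move=> j j0; rewrite -scaler_suml.
under eq_bigr do rewrite exprMn.
rewrite -mulr_sumr sum_unity_powers ?mulr0 ?scale0r //.
by rewrite lt0n j0 ltn_ord.
Qed.

(** The weights lower each exponent by one, so the linear coefficient survives. The constant term
    gets exponent [-1], that is [n.+1], which is nonzero modulo the order because there are at least
    two nodes. *)
Lemma average_linear n (u : nat -> V) w (z : C) : n.+2.-primitive_root w ->
  \sum_(k < n.+2) (w ^+ k)^-1 *: \sum_(j < n.+2) (z * w ^+ k) ^+ j *: u j =
  n.+2%:R *: (z *: u 1).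
Proof.
move=> pw.
have w0 : w != 0.
  by apply/eqP => w0; have := prim_expr_order pw; rewrite w0 expr0n /= => /eqP;
    rewrite eq_sym oner_eq0.
under eq_bigr do rewrite scaler_sumr.
have E (k j : nat) : (w ^+ k)^-1 * (z * w ^+ k) ^+ j =
    z ^+ j * (w ^+ k) ^+ (if j is j'.+1 then j' else n.+1).
  have wk0 : w ^+ k != 0 by rewrite expf_neq0.
  case: j => [|j]; last by rewrite exprMn [(w ^+ k) ^+ j.+1]exprS mulrCA mulKf.
  rewrite !expr0 mulr1 mul1r; apply: (mulfI wk0); rewrite mulfV // -exprS.
  by rewrite exprAC (prim_expr_order pw) expr1n.
rewrite exchange_big /= (bigD1 (lift ord0 ord0)) //= [X in _ + X]big1 ?addr0.
  rewrite (eq_bigr (fun=> z *: u 1)) ?sumr_const ?card_ord ?scaler_nat // => k _.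
  by rewrite scalerA E /bump /= mulr1.
move=> j j1.
under eq_bigr do rewrite scalerA E.
rewrite -scaler_suml -mulr_sumr sum_unity_powers ?mulr0 ?scale0r //.
case: j j1 => [[|[|j]] /= lj] // nj.
by rewrite ltnW.
Qed.
End Averages.

Section Seminorm.
Variables (V : lmodType C) (q : V -> R).
Hypothesis qD : forall x y, q (x + y) <= q x + q y.
Hypothesis qZ : forall (a : C) x, q (a *: x) = normc a * q x.

Lemma seminorm0 : q 0 = 0.
Proof. by rewrite -(scale0r (0 : V)) qZ normc0 mul0r. Qed.

Lemma seminorm_ge0 x : 0 <= q x.
Proof.
have := qD x (- x); rewrite subrr seminorm0 -scaleN1r qZ normcN normc1 mul1r.
lra.
Qed.

Lemma seminorm_sum (I : Type) (r : seq I) (F : I -> V) :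
  q (\sum_(i <- r) F i) <= \sum_(i <- r) q (F i).
Proof.
elim: r => [|i r IH]; first by rewrite !big_nil seminorm0.
by rewrite !big_cons (le_trans (qD _ _)) // lerD2l.
Qed.

(** Cauchy's estimate on the circle of radius [rho]. Seminorms are the right generality: besides the
    norm of an algebra, the modulus of a linear functional is used as [q]. *)
Lemma seminorm_linear_coef (n : nat) (u : nat -> V) (rho K : R) :
  0 <= rho ->
  (forall z, normc z = rho -> q (\sum_(j < n.+2) z ^+ j *: u j) <= K) ->
  rho * q (u 1) <= K.
Proof.
move=> rho0 H; have [//|w pw] := @primitive_root_exists n.+2.
have nw k : normc (w ^+ k) = 1.
  by rewrite normcX (normc_unity _ (prim_expr_order pw)) ?expr1n.
have := average_linear u rho%:C pw => /(congr1 q).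
rewrite !qZ normc_nat normc_real ger0_norm // => E.
have n0 : 0 < n.+2%:R :> R by rewrite ltr0n.
rewrite -(ler_pM2l n0) -E (le_trans (seminorm_sum _ _)) //.
rewrite (@le_trans _ _ (\sum_(k < n.+2) K)) //.
  apply: ler_sum => k _; rewrite qZ normcV nw invr1 mul1r H //.
  by rewrite normcM nw mulr1 normc_real ger0_norm.
by rewrite sumr_const card_ord mulr_natl.
Qed.

End Seminorm.

Section PowerBound.
Variable (A : algType C).

Lemma subX_one_scale (x : A) z n :
  (1 - z *: x) ^+ n = \sum_(j < n.+1) z ^+ j *: (((-1) ^+ j * 'C(n, j)%:R) *: x ^+ j).
Proof.
rewrite -scaleNr exprDn_comm; last exact: commr_sym (commr1 _).
apply: eq_bigr => j _.
rewrite expr1n mul1r exprZn -scaler_nat !scalerA [(- z) ^+ j]exprNn.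
by congr (_ *: _); ring.
Qed.

(** The linear coefficient of [(1 - z x)^n] is [- n x], so Cauchy's estimate gains a factor [n]. If
    [K] can be chosen independently of [n], this forces [q x = 0]. *)
Lemma seminorm_power_bound (q : A -> R) (x : A) (n : nat) (rho K : R) :
  (forall x y, q (x + y) <= q x + q y) ->
  (forall (a : C) x, q (a *: x) = normc a * q x) ->
  0 <= rho ->
  (forall z, normc z = rho -> q ((1 - z *: x) ^+ n) <= K) ->
  n%:R * rho * q x <= K.
Proof.
move=> qD qZ rho0 H.
case: n H => [|n] H.
  rewrite !mul0r; have := H rho%:C; rewrite normc_real ger0_norm // => /(_ erefl).
  by apply: le_trans; rewrite expr0 (seminorm_ge0 qD qZ).
pose u j := ((-1) ^+ j * 'C(n.+1, j)%:R) *: x ^+ j.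
have : rho * q (u 1%N) <= K.
  apply: (seminorm_linear_coef qD qZ rho0) => z zr.
  have := H z zr; rewrite subX_one_scale. exact.
by rewrite /u qZ bin1 normcM expr1 normcN normc1 mul1r normc_nat mulrA [rho * _]mulrC.
Qed.
End PowerBound.

(** All powers of [1 - z h] stay in the unit ball, so the power bound holds with [K = 1] for every
    [n]: the unit is a complex extreme point of the ball. *)
Lemma isometric_perturbation_eq0 (A : CBanachAlg) (h : A) (rho : R) :
  0 < rho -> (forall z, normc z = rho -> norm (1 - z *: h) <= 1) -> h = 0.
Proof.
move=> rho0 H; apply: norm_eq0r; rewrite leNgt; apply/negP => h0.
have p0 : 0 < rho * norm h by rewrite mulr_gt0.
pose n := Num.bound (rho * norm h)^-1.
have nP : (rho * norm h)^-1 < n%:R by rewrite archi_boundP // invr_ge0 ltW.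
have : n%:R * rho * norm h <= 1.
  apply: (seminorm_power_bound (@normD A) (@normZ A) (ltW rho0)) => z zr.
  by rewrite (le_trans (normX_le _ _)) // exprn_ile1 ?norm_ge0r ?H.
by rewrite -mulrA leNgt -ltr_pdivrMr // div1r nP.
Qed.

(** * Gelfand-Mazur and characters *)

Section GelfandMazur.
Variables (A : comAlgType C) (q : A -> R).
Hypothesis qD : forall x y, q (x + y) <= q x + q y.
Hypothesis qZ : forall (a : C) x, q (a *: x) = normc a * q x.
Hypothesis qM : forall x y, q (x * y) <= q x * q y.
Hypothesis q1 : q 1 = 1.

Let q_ge0 := seminorm_ge0 qD qZ.

Lemma seminormN x : q (- x) = q x.
Proof. by rewrite -scaleN1r qZ normcN normc1 mul1r. Qed.

Lemma seminorm_le_congr x y : q (x - y) = 0 -> q x <= q y.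
Proof. by move=> e; rewrite -[x](subrK y) (le_trans (qD _ _)) // e add0r. Qed.

Lemma seminorm_mul_null x y : q y = 0 -> q (x * y) = 0.
Proof.
move=> y0; apply/eqP; rewrite eq_le q_ge0 andbT.
by rewrite (le_trans (qM _ _)) // y0 mulr0.
Qed.

Lemma seminorm_add_null x y : q x = 0 -> q y = 0 -> q (x + y) = 0.
Proof.
move=> x0 y0; apply/eqP; rewrite eq_le q_ge0 andbT.
by rewrite (le_trans (qD _ _)) // x0 y0 addr0.
Qed.

Variables (a : A) (s : C -> A).
Hypothesis s_inv : forall z, q ((1 - z *: a) * s z - 1) = 0.

(** The resolvent identity [s w - s z = (w - z) a (s w) (s z)]. It holds only up to elements of
    seminorm zero, since [s] inverts [1 - z a] modulo the null space of [q]. *)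
Lemma resolvent_diff z w :
  q (s w - s z) <= normc (w - z) * q a * q (s w) * q (s z).
Proof.
rewrite (@le_trans _ _ (q ((w - z) *: (a * s w * s z)))) //; last first.
  rewrite qZ -!mulrA ler_wpM2l ?normc_ge0 //.
  rewrite mulrA (le_trans (qM _ _)) //.
  by rewrite mulrA ler_wpM2r ?q_ge0 ?qM.
apply: seminorm_le_congr.
have -> : s w - s z - (w - z) *: (a * s w * s z) =
  - s w * ((1 - z *: a) * s z - 1) + s z * ((1 - w *: a) * s w - 1).
  have Z1 (c : C) (x : A) : c *: x = c%:A * x by rewrite mulr_algl.
  rewrite scalerBl !(Z1 _ a) !(Z1 _ (a * _ * _)); ring.
by apply: seminorm_add_null; apply: seminorm_mul_null.
Qed.

Lemma normc_le_ReIm (z : C) : normc z <= `|complex.Re z| + `|complex.Im z|.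
Proof.
case: z => x y /=.
rewrite -[leRHS]ger0_norm ?addr_ge0 // -sqrtr_sqr ler_sqrt ?sqr_ge0 //.
by rewrite sqrrD !real_normK ?num_real // lerD2r lerDl mulrn_wge0 ?mulr_ge0.
Qed.

Lemma Re_Im_le_normc (z : C) :
  `|complex.Re z| <= normc z /\ `|complex.Im z| <= normc z.
Proof.
case: z => x y /=; rewrite -!sqrtr_sqr !ler_sqrt ?addr_ge0 ?sqr_ge0 //.
by rewrite lerDl lerDr !sqr_ge0.
Qed.

(** By the resolvent identity [q (s z) <= 2 q (s w)] on a square around [w] of half-side
    [(4 (q a + 1) (q (s w) + 1))^-1]. Compactness gives a common lower bound [d] for the half-sides
    of a family of such squares that covers the disc; since the half-side also controls [q (s w)],
    the resolvent is bounded by [d^-1]. *)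
Lemma resolvent_bounded rho :
  exists2 M, 0 < M & forall z, normc z <= rho -> q (s z) <= M.
Proof.
have dP (u v : R) : Rlt 0 (4 * (q a + 1) * (q (s (u +i* v)) + 1))^-1.
  apply/RltP; rewrite invr_gt0 !mulr_gt0 // ltr_wpDl ?q_ge0 //.
have [d dH] := Compactness.compactness_value_2d (- rho) rho (- rho) rho
  (fun u v => RIneq.mkposreal _ (dP u v)).
have d0 : 0 < RIneq.pos d by apply/RltP; case: d {dH}.
exists (RIneq.pos d)^-1; first by rewrite invr_gt0.
move=> z zr; apply: contrapT => nle.
have [xle yle] := Re_Im_le_normc z.
apply: (dH (complex.Re z) (complex.Im z)).
- by move: (le_trans xle zr); rewrite ler_norml => /andP[? ?]; split; apply/RleP.
- by move: (le_trans yle zr); rewrite ler_norml => /andP[? ?]; split; apply/RleP.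
case=> u [v [_ [_ [/RltP xu [/RltP yv /RleP]]]]] /=.
move: xu yv; rewrite /= !RabsE !RminusE.
set S := q (s (u +i* v)); set D := (_ * _ * _)^-1 => xu yv dD.
apply: nle.
have S0 : 0 <= S := q_ge0 _.
have a0 := q_ge0 a.
have z0 := q_ge0 (s z).
have E0 : 0 < 4 * (q a + 1) * (S + 1) by rewrite !mulr_gt0 // ltr_wpDl.
have dist : normc (z - (u +i* v)) <= D + D.
  case: z {zr xle yle z0} xu yv => x y /= xu yv.
  by rewrite (le_trans (normc_le_ReIm (_ +i* _))) //= lerD // ltW.
have DE : (D + D) * ((q a + 1) * (S + 1)) = 2^-1.
  by rewrite /D; field; rewrite !gt_eqF // ltr_wpDl.
have : q (s z - s (u +i* v)) <= 2^-1 * q (s z).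
  rewrite (le_trans (resolvent_diff _ _)) // -DE.
  rewrite -!mulrA; apply: ler_pM => //; first exact: normc_ge0.
    by rewrite !mulr_ge0.
  by have := mulr_ge0 a0 z0; have := mulr_ge0 S0 z0; rewrite -/S; nra.
have : q (s z) <= q (s z - s (u +i* v)) + S.
  by rewrite -{1}[s z](subrK (s (u +i* v))) qD.
move=> h1 h2; have h3 : q (s z) <= 2 * S by lra.
have h4 : D^-1 <= (RIneq.pos d)^-1 by rewrite lef_pV2 ?posrE ?invr_gt0.
rewrite (le_trans h3) // (le_trans _ h4) // /D invrK; nra.
Qed.

(* The average of the resolvent over the n-th roots of unity is the inverse of
   [1 - (t a)^n]; since the resolvent is Lipschitz on discs, the decay of
   [t^n q (a^n)] propagates to larger [t] in steps of constant length, with no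
   complex integration. *)
Lemma average_resolvent n (w t : C) : n.+1.-primitive_root w ->
  q ((1 - (t *: a) ^+ n.+1) * (n.+1%:R^-1 *: \sum_(k < n.+1) s (t * w ^+ k)) - 1) = 0.
Proof.
move=> pw.
have n0 : n.+1%:R != 0 :> C by rewrite pnatr_eq0.
have E : n.+1%:R^-1 *: \sum_(k < n.+1) \sum_(j < n.+1) (t * w ^+ k) ^+ j *: a ^+ j = 1 :> A.
  by rewrite (average_const (fun j => a ^+ j)) // scalerA mulVf // scale1r expr0.
rewrite -[X in _ - X]E -scalerAr -scalerBr qZ mulr_sumr -sumrB.
apply/eqP; rewrite mulf_eq0; apply/orP; right.
rewrite eq_le q_ge0 andbT (le_trans (seminorm_sum qD qZ _ _)) //.
rewrite big1 // => k _.
pose y := (t * w ^+ k) *: a.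
have -> : (t *: a) ^+ n.+1 = y ^+ n.+1.
  by rewrite !exprZn exprMn exprAC (prim_expr_order pw) expr1n mulr1.
rewrite -[1 - y ^+ n.+1]opprB subrX1 -mulNr opprB.
have -> : \sum_(j < n.+1) (t * w ^+ k) ^+ j *: a ^+ j = \sum_(j < n.+1) y ^+ j.
  by apply: eq_bigr => j _; rewrite exprZn.
rewrite -[X in _ - X]mulr1 [(1 - y) * _]mulrC -mulrA -mulrBr.
exact/seminorm_mul_null/s_inv.
Qed.

(** Expresses that the spectral radius of [a] is at most [1 / t]; holding for all [t], it makes [a]
    quasinilpotent. *)
Let geometric t := forall eps : R, 0 < eps ->
  exists N, forall n, (N <= n)%N -> t ^+ n * q (a ^+ n) <= eps.

Lemma geometric_smaller t t' : 0 <= t < t' ->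
  (exists N, forall n, (N <= n)%N -> t' ^+ n * q (a ^+ n) <= 1) -> geometric t.
Proof.
move=> /andP[t0 tt'] [N HN] eps eps0.
have t'0 : 0 < t' by apply: le_lt_trans tt'.
have r0 : 0 <= t / t' by rewrite divr_ge0 // ltW.
have rlt1 : Rlt (Rabs (t / t')) 1.
  by apply/RltP; rewrite RabsE ger0_norm // ltr_pdivrMr // mul1r.
have eps0' : Rlt 0 eps by apply/RltP.
have [N' HN'] := pow_lt_1_zero _ rlt1 _ eps0'.
exists (maxn N N') => n; rewrite geq_max => /andP[Nn N'n].
have /RltP := HN' n (ssrnat.leP N'n).
rewrite RabsE RpowE ger0_norm ?exprn_ge0 // => lt_eps.
have -> : t ^+ n = (t / t') ^+ n * t' ^+ n by rewrite -exprMn divfK // gt_eqF.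
rewrite -mulrA (le_trans _ (ltW lt_eps)) // ler_piMr ?exprn_ge0 //.
exact: HN.
Qed.

Lemma seminorm_average_le n (w : C) (t M : R) : n.+1.-primitive_root w -> 0 <= t ->
  (forall z, normc z <= t -> q (s z) <= M) ->
  q (n.+1%:R^-1 *: \sum_(k < n.+1) s (t%:C * w ^+ k)) <= M.
Proof.
move=> pw t0 HM; rewrite qZ normcV normc_nat.
have n0 : 0 < n.+1%:R :> R by rewrite ltr0n.
rewrite mulrC ler_pdivrMr // (le_trans (seminorm_sum qD qZ _ _)) //.
rewrite (@le_trans _ _ (\sum_(k < n.+1) M)) //; last first.
  by rewrite sumr_const card_ord mulr_natr.
apply: ler_sum => k _; apply: HM.
by rewrite normcM normcX (normc_unity _ (prim_expr_order pw)) // expr1n mulr1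
  normc_real ger0_norm.
Qed.

(** Let [y = (u a)^(n+1)], so that the average inverts [1 - y]. At [u = t] the average is within
    [1/4] of [1] by decay, and the Lipschitz bound costs another [1/4] on the way to [u = t + 2 d].
    There [e = avg - 1] has [q e <= 1/2], and [y = e - y e] yields [q y <= 1]. Falling back to
    [t + d] turns this boundedness into decay. *)
Lemma geometric_step M t d : 0 < M -> 0 <= t -> 0 < d ->
  (forall z, normc z <= t + 2 * d -> q (s z) <= M) ->
  2 * d * q a * M ^+ 2 <= 4^-1 ->
  geometric t -> geometric (t + d).
Proof.
move=> M0 t0 d0 HM small gt.
have a0 := q_ge0 a.
apply: (@geometric_smaller _ (t + 2 * d)).
  by apply/andP; split; lra.
have [|N HN] := gt (4 * M)^-1; first by rewrite invr_gt0 mulr_gt0.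
exists N.+1 => -[//|n] /ltnW Nn.
have [//|w pw] := @primitive_root_exists n.+1.
pose avg (u : R) := n.+1%:R^-1 *: \sum_(k < n.+1) s (u%:C * w ^+ k).
pose y (u : R) := (u%:C *: a) ^+ n.+1.
have qy u : 0 <= u -> q (y u) = u ^+ n.+1 * q (a ^+ n.+1).
  by move=> u0; rewrite /y exprZn qZ normcX normc_real ger0_norm.
have avgP u : q ((1 - y u) * avg u - 1) = 0 by apply: average_resolvent.
have t'0 : 0 <= t + 2 * d by lra.
have avg_M : q (avg t) <= M.
  by apply: seminorm_average_le pw t0 _ => z zt; apply: HM; lra.
have avg1 : q (avg t - 1) <= 4^-1.
  have -> : avg t - 1 = ((1 - y t) * avg t - 1) + y t * avg t by ring.
  rewrite (le_trans (qD _ _)) // avgP add0r (le_trans (qM _ _)) // qy //.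
  have := HN _ Nn; set c := t ^+ _ * _ => cM.
  have c0 : 0 <= c by rewrite mulr_ge0 ?exprn_ge0.
  have -> : 4^-1 = (4 * M)^-1 * M by field; rewrite gt_eqF.
  exact: ler_pM.
have avg_diff : q (avg (t + 2 * d) - avg t) <= 4^-1.
  rewrite -scalerBr -sumrB qZ normcV normc_nat.
  have n0 : 0 < n.+1%:R :> R by rewrite ltr0n.
  rewrite mulrC ler_pdivrMr // (le_trans (seminorm_sum qD qZ _ _)) //.
  rewrite (@le_trans _ _ (\sum_(k < n.+1) 4^-1)) //; last first.
    by rewrite sumr_const card_ord mulr_natr.
  apply: ler_sum => k _; rewrite (le_trans (resolvent_diff _ _)) //.
  have nw : normc (w ^+ k) = 1.
    by rewrite normcX (normc_unity _ (prim_expr_order pw)) // expr1n.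
  have nz u : 0 <= u -> normc (u%:C * w ^+ k) = u.
    by move=> u0; rewrite normcM nw mulr1 normc_real ger0_norm.
  rewrite -mulrBl -raddfB /= normcM nw mulr1 normc_real.
  rewrite (_ : t + 2 * d - t = 2 * d); last by ring.
  rewrite ger0_norm; last by lra.
  apply: le_trans small; rewrite expr2 -!mulrA.
  rewrite !ler_wpM2l //; first by lra.
  by apply: ler_pM => //; apply: HM; rewrite nz //; lra.
set t' := t + 2 * d in avg_diff t'0 *.
set e := avg t' - 1.
have e2 : q e <= 2^-1.
  have -> : e = (avg t' - avg t) + (avg t - 1) by rewrite /e; ring.
  by rewrite (le_trans (qD _ _)) //; lra.
rewrite -qy //.
have : q (y t') <= q (e - y t' * e).
  apply: seminorm_le_congr.
  have -> : y t' - (e - y t' * e) = - ((1 - y t') * avg t' - 1) by rewrite /e; ring.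
  by rewrite seminormN.
have := qM (y t') e; have := qD e (- (y t' * e)); rewrite seminormN.
have := q_ge0 (y t'); have := q_ge0 e.
nra.
Qed.

Lemma geometric_all t : 0 < t -> geometric t.
Proof.
move=> t0; have [M M0 HM] := resolvent_bounded (2 * t).
have a0 := q_ge0 a.
(* For [m > K] a step [d = t / m] satisfies [2 d q(a) M^2 <= 1/4]. The bound [M] is taken on radius
   [2 t] to leave room for the overshoot by [2 d]. *)
pose K := 8 * t * q a * M ^+ 2.
have K0 : 0 <= K by rewrite !mulr_ge0 ?exprn_ge0 // ltW.
pose m := (Num.bound K).+1.
have Km : K < m%:R.
  by rewrite (lt_le_trans (archi_boundP K0)) // ler_nat.
have m0 : 0 < m%:R :> R by rewrite ltr0n.
have H k : (k <= m)%N -> geometric (k%:R * (t / m%:R)).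
  elim: k => [_|k IH km].
    move=> eps eps0; exists 1%N => -[//|n] _.
    by rewrite mul0r expr0n mul0r ltW.
  rewrite -natr1 mulrDl mul1r.
  have d0 : 0 < t / m%:R by rewrite divr_gt0.
  have kd : (k.+1)%:R * (t / m%:R) <= t.
    by rewrite mulrCA ler_piMr ?(ltW t0) // ler_pdivrMr // mul1r ler_nat.
  apply: (@geometric_step M) => //.
  - by rewrite mulr_ge0 ?(ltW d0).
  - move=> z zt; apply: HM; apply: le_trans zt _.
    have : t / m%:R <= t by rewrite ler_pdivrMr // ler_peMr ?ler1n // ltW.
    by move: kd; rewrite -natr1 mulrDl mul1r; lra.
  - have -> : 2 * (t / m%:R) * q a * M ^+ 2 = (K / m%:R) / 4.
      by rewrite /K; field; rewrite gt_eqF.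
    by rewrite ler_piMl ?invr_ge0 // ler_pdivrMr // mul1r ltW.
  - exact/IH/ltnW.
by have := H m (leqnn _); rewrite mulrCA divff ?mulr1 // gt_eqF.
Qed.

(** [a] is quasinilpotent and yet inverted by [b]: modulo null elements [1 = a^N b^N], whose
    seminorm is at most [1/2] for a suitable [N]. *)
Lemma resolvent_everywhere_absurd b : q (a * b - 1) = 0 -> False.
Proof.
move=> ab.
have b0 := q_ge0 b.
have t0 : 0 < q b + 1 by lra.
have e0 : 0 < 2^-1 :> R by lra.
have [N HN] := geometric_all t0 e0.
have h := HN N (leqnn _).
have : q 1 <= q ((a * b) ^+ N).
  apply: seminorm_le_congr; rewrite -opprB seminormN subrX1 mulrC.
  exact: seminorm_mul_null.
rewrite q1 exprMn => h1.
have h2 := qM (a ^+ N) (b ^+ N).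
have h3 : q (b ^+ N) <= (q b + 1) ^+ N.
  apply: (@le_trans _ _ (q b ^+ N)).
    elim: N {HN h h1 h2} => [|n IH]; first by rewrite !expr0 q1.
    by rewrite !exprS (le_trans (qM _ _)) // ler_wpM2l.
  by apply: lerXn2r; rewrite ?nnegrE; lra.
have := q_ge0 (a ^+ N).
nra.
Qed.
End GelfandMazur.

(** The proof of commutativity is an argument of the alias, so that canonical commutative structures
    can be attached to it while [A] keeps its general ring structure. *)
Definition comm_car (A : CBanachAlg) (_ : commutative A) : Type := A.

Section CommutativeInstances.
Variables (A : CBanachAlg) (hc : commutative A).
HB.instance Definition _ := GRing.NzRing.copy (comm_car hc) (car A).
HB.instance Definition _ := GRing.Algebra.copy (comm_car hc) (car A).
HB.instance Definition _ :=
  GRing.PzRing_hasCommutativeMul.Build (comm_car hc) hc.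
End CommutativeInstances.

Definition character (A : CBanachAlg) (chi : A -> C) : Prop :=
  [/\ forall (a : C) x y, chi (a *: x + y) = a * chi x + chi y,
      forall x y, chi (x * y) = chi x * chi y,
      chi 1 = 1
    & forall x, normc (chi x) <= norm x].

(** * Quotient seminorms of maximal ideals and the resulting characters *)

Section MaximalIdeal.
Variables (A : CBanachAlg) (hc : commutative A).
Notation K := (comm_car hc).
Variable I : K -> Prop.
Hypothesis maxI : @maximal_left_ideal A I.

Lemma ideal0 : I 0.
Proof. by case: maxI => [[]]. Qed.

Lemma idealD x y : I x -> I y -> I (x + y).
Proof. by case: maxI => [[_ [h _]] _]; apply: h. Qed.

Lemma idealM a x : I x -> I (a * x).
Proof. by case: maxI => [[_ [_ h]] _]; apply: h. Qed.

Lemma ideal1 : ~ I 1.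
Proof. by case: maxI => [_ []]. Qed.

Lemma idealZ (c : C) x : I x -> I (c *: x).
Proof. by move=> Ix; rewrite -mulr_algl; apply: idealM. Qed.

Lemma idealB x y : I x -> I y -> I (x - y).
Proof. by move=> Ix Iy; rewrite -scaleN1r; apply/idealD/idealZ. Qed.

Lemma ideal_inverse x : ~ I x -> exists y, I (x * y - 1).
Proof.
move=> nIx; apply: contrapT => nex.
case: maxI => [_ [_ mx]]; apply: nIx.
apply: (mx (fun z => exists2 m, I m & exists y, z = m + y * x)); last 1 first.
- by exists 0; [exact: ideal0|exists 1; rewrite mul1r add0r].
- split; first by exists 0; [exact: ideal0|exists 0; rewrite mul0r addr0].
  split=> [_ _ [m Im [y ->]] [m' Im' [y' ->]]|b _ [m Im [y ->]]].
    exists (m + m'); first exact: idealD.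
    by exists (y + y'); rewrite mulrDl addrACA.
  exists (b * m); first exact: idealM.
  by exists (b * y); rewrite -mulrA -mulrDr.
- by move=> m Im; exists m => //; exists 0; rewrite mul0r addr0.
move=> [m Im [y E]]; apply: nex; exists y.
rewrite [X in _ - X](E : 1 = m + y * x) [x * y]mulrC opprD addrCA subrr addr0.
by rewrite -scaleN1r; apply: idealZ.
Qed.

Local Open Scope classical_set_scope.

Definition coset_norms (x : K) : set R := [set norm (x + m : A) | m in I].

(** The norm of the quotient by [I], pulled back to the algebra so that no quotient has to be
    formed. *)
Definition quotient_seminorm (x : K) : R := inf (coset_norms x).

Lemma coset_norms_has_inf x : has_inf (coset_norms x).
Proof.
split; first by exists (norm (x + 0 : A)), 0; first exact: ideal0.
by exists 0 => _ [m _ <-]; apply: norm_ge0r.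
Qed.

Lemma quotient_seminorm_le x m : I m -> quotient_seminorm x <= norm (x + m : A).
Proof. by move=> Im; apply: ge_inf; [case: (coset_norms_has_inf x)|exists m]. Qed.

Lemma quotient_seminorm_ge x r : (forall m, I m -> r <= norm (x + m : A)) ->
  r <= quotient_seminorm x.
Proof.
move=> H; apply: lb_le_inf; first by case: (coset_norms_has_inf x).
by move=> _ [m Im <-]; apply: H.
Qed.

Lemma quotient_seminorm_le_norm x : quotient_seminorm x <= norm (x : A).
Proof. by have := quotient_seminorm_le x ideal0; rewrite addr0. Qed.

Lemma quotient_seminormD x y :
  quotient_seminorm (x + y) <= quotient_seminorm x + quotient_seminorm y.
Proof.
rewrite -lerBlDl; apply: quotient_seminorm_ge => m Im; rewrite lerBlDl -lerBlDr.
apply: quotient_seminorm_ge => m' Im'; rewrite lerBlDr.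
apply: le_trans (quotient_seminorm_le _ (idealD Im' Im)) _.
by rewrite addrACA normD.
Qed.

Lemma quotient_seminorm0 x : I x -> quotient_seminorm x = 0.
Proof.
move=> Ix; apply/eqP; rewrite eq_le; apply/andP; split; last first.
  by apply: quotient_seminorm_ge => m _; apply: norm_ge0r.
have := quotient_seminorm_le x (idealZ (-1) Ix).
by rewrite scaleN1r subrr norm0.
Qed.

Lemma quotient_seminormZ (c : C) x :
  quotient_seminorm (c *: x) = normc c * quotient_seminorm x.
Proof.
have le (d : C) y : quotient_seminorm (d *: y) <= normc d * quotient_seminorm y.
  have [->|d0] := eqVneq d 0.
    by rewrite scale0r normc0 mul0r quotient_seminorm0 //; apply: ideal0.
  have nd : 0 < normc d by rewrite lt_neqAle normc_ge0 eq_sym normc_eq0 d0.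
  rewrite -ler_pdivrMl //; apply: quotient_seminorm_ge => m Im.
  rewrite ler_pdivrMl // -normZ scalerDr.
  exact/quotient_seminorm_le/idealZ.
apply/eqP; rewrite eq_le le /=.
have [->|c0] := eqVneq c 0.
  rewrite scale0r normc0 mul0r; apply: quotient_seminorm_ge => *.
  exact: norm_ge0r.
have nc : 0 < normc c by rewrite lt_neqAle normc_ge0 eq_sym normc_eq0 c0.
by rewrite mulrC -ler_pdivlMr // mulrC -normcV -{1}[x](scalerK c0) le.
Qed.

Lemma quotient_seminormM x y :
  quotient_seminorm (x * y) <= quotient_seminorm x * quotient_seminorm y.
Proof.
have le0 z : 0 <= quotient_seminorm z.
  by apply: quotient_seminorm_ge => *; apply: norm_ge0r.
have H m m' : I m -> I m' ->
    quotient_seminorm (x * y) <= norm (x + m : A) * norm (y + m' : A).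
  move=> Im Im'; rewrite (le_trans _ (normM_le _ _)) //.
  have -> : (x + m : A) * (y + m' : A) = x * y + (x * m' + y * m + m * m') :> K.
    by rewrite -[LHS]/((x + m : K) * (y + m' : K)); ring.
  by apply: quotient_seminorm_le; do !apply: idealD; apply: idealM.
have H1 m : I m ->
    quotient_seminorm (x * y) <= norm (x + m : A) * quotient_seminorm y.
  move=> Im; have := norm_ge0r (x + m : A); rewrite le_eqVlt => /orP[/eqP n0|n0].
    have := H m 0 Im ideal0; rewrite -n0 !mul0r; exact.
  rewrite -ler_pdivrMl //; apply: quotient_seminorm_ge => m' Im'.
  by rewrite ler_pdivrMl // H.
have := le0 y; rewrite le_eqVlt => /orP[/eqP n0|n0].
  by have := H1 0 ideal0; rewrite -n0 !mulr0.
rewrite -ler_pdivrMr //; apply: quotient_seminorm_ge => m Im.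
by rewrite ler_pdivrMr // H1.
Qed.

Variable eps : R.
Hypothesis eps_gt0 : 0 < eps.
Hypothesis ball_invertible : forall x : A, norm (x - 1) < eps -> invertible x.

(** An element of [I] within [eps] of [-1] would be invertible up to sign and put [1] in [I], so the
    value is at least [eps]. Being positive and at most its own square, it is at least one. *)
Lemma quotient_seminorm1 : quotient_seminorm 1 = 1.
Proof.
apply/eqP; rewrite eq_le; apply/andP; split.
  by rewrite (le_trans (quotient_seminorm_le_norm _)) // norm1.
have ge_eps : eps <= quotient_seminorm 1.
  apply: quotient_seminorm_ge => m Im; rewrite leNgt; apply/negP => lt_eps.
  have [|y [_ /= yE]] := ball_invertible (x := - m).
    by rewrite -opprD normN addrC.
  apply: ideal1; rewrite -(yE : (y : K) * - m = 1).
  by rewrite mulrN -mulNr; apply: idealM.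
have := quotient_seminormM 1 1; rewrite mulr1 -{1}[quotient_seminorm 1]mulr1.
by rewrite ler_pM2l // (lt_le_trans eps_gt0).
Qed.

(** Otherwise each [a - z] has an inverse [r z] modulo [I]. Since [1 - z a = - z (a - z^-1)], this
    provides a resolvent [s] on the whole plane, with value [1] at the origin, and [r 0] inverts [a]
    itself: exactly the situation excluded by Gelfand-Mazur. *)
Lemma residue_scalar a : exists z : C, I (a - z%:A).
Proof.
apply: contrapT => nz.
have inv z : exists y, I ((a - z%:A) * y - 1).
  by apply: ideal_inverse => Iz; apply: nz; exists z.
have [r rP] := choice inv.
pose s z := if z == 0 then 1 else (- z)^-1 *: r z^-1.
have sP z : quotient_seminorm ((1 - z *: a) * s z - 1) = 0.
  rewrite /s; have [->|z0] := eqVneq z 0.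
    by rewrite scale0r subr0 mulr1 subrr quotient_seminorm0 //; apply: ideal0.
  have -> : 1 - z *: a = (- z) *: (a - z^-1%:A).
    by rewrite scaleNr scalerBr scalerA mulfV // scale1r opprB.
  rewrite -scalerAl -scalerAr scalerA mulfV ?oppr_eq0 // scale1r.
  exact/quotient_seminorm0/rP.
apply: (resolvent_everywhere_absurd quotient_seminormD quotient_seminormZ
  quotient_seminormM quotient_seminorm1 sP (b := r 0)).
by have := rP 0; rewrite scale0r subr0; apply: quotient_seminorm0.
Qed.

Lemma residue_character :
  exists2 chi : A -> C, character chi & forall x, chi x = 0 -> I x.
Proof.
have [chi chiP] := choice residue_scalar.
have uniq (x : K) (z : C) : I (x - z%:A) -> chi x = z.
  move=> Iz; apply: contrapT => /eqP; rewrite -subr_eq0 => nz.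
  apply: ideal1; rewrite -(scale1r (1 : K)) -(mulVf nz) -scalerA; apply: idealZ.
  have -> : (chi x - z) *: 1 = (x - z%:A) - (x - (chi x)%:A) :> K.
    by rewrite scalerBl opprB [RHS]addrC addrA subrK.
  exact: idealB.
exists chi; last by move=> x x0; have := chiP x; rewrite x0 scale0r subr0.
split.
- move=> c x y; apply: uniq.
  have -> : c *: x + y - (c * chi x + chi y)%:A =
      c *: (x - (chi x)%:A) + (y - (chi y)%:A) :> K.
    by rewrite scalerDl scalerBr scalerA opprD addrACA.
  by apply: idealD => //; apply: idealZ.
- move=> x y; apply: uniq.
  have -> : x * y - (chi x * chi y)%:A =
      (chi y) *: (x - (chi x)%:A) + x * (y - (chi y)%:A) :> K.
    by rewrite scalerBr scalerA mulrBr -scalerAr mulr1 [chi y * _]mulrC [RHS]addrC addrA subrK.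
  by apply: idealD; [apply: idealZ|apply: idealM].
- by apply: uniq; rewrite scale1r subrr; apply: ideal0.
move=> x; rewrite -[normc _]mulr1 -quotient_seminorm1 -quotient_seminormZ.
rewrite (le_trans _ (quotient_seminorm_le_norm x)) //.
apply: (seminorm_le_congr quotient_seminormD).
by rewrite -opprB -scaleN1r; apply/quotient_seminorm0/idealZ.
Qed.

End MaximalIdeal.

Lemma characters_separate (A : CBanachAlg) (eps : R) (x : A) :
  commutative A -> semisimple A ->
  0 < eps -> (forall y : A, norm (y - 1) < eps -> invertible y) ->
  (forall chi : A -> C, character chi -> chi x = 0) -> x = 0.
Proof.
move=> hc ss eps0 ball H; apply: ss => I maxI.
have [chi chiP ker] := @residue_character A hc I maxI eps eps0 ball.
exact/ker/H.
Qed.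

(** * Gleason-Kahane-Zelazko *)

(** Newton's identity for the second power sum, the [r] being inverse roots. *)
Lemma newton2_prod (rs : seq C) :
  let p := \prod_(r <- rs) (1 - r *: 'X) in
  p`_0 = 1 /\ p`_1 ^+ 2 - 2 * p`_2 = \sum_(r <- rs) r ^+ 2.
Proof.
elim: rs => [|r rs [IH0 IH]]; first by rewrite /= !big_nil !coef1 /=; split=> //; ring.
rewrite /= !big_cons !mulrBl !mul1r -!scalerAl !coefB !coefZ !coefXM /= IH0 -IH.
by split; ring.
Qed.

(** The left-hand side is the second power sum of the inverse roots; there are at most [n] of them,
    each of modulus below [1 / rho]. *)
Lemma power_sum2_bound (f : {poly C}) (rho : R) n :
  0 < rho -> f`_0 = 1 -> (size f <= n.+1)%N ->
  (forall z, normc z <= rho -> f.[z] != 0) ->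
  rho ^+ 2 * normc (f`_1 ^+ 2 - 2 * f`_2) <= n%:R.
Proof.
move=> rho0 f0 sf nz; have [rs frs] := closed_field_poly_normal f.
have fn0 : f != 0 by apply: contra_eq_neq f0 => ->; rewrite coef0 eq_sym oner_eq0.
have lc0 : lead_coef f != 0 by rewrite lead_coef_eq0.
have srs : (size rs <= n)%N.
  by move: sf; rewrite frs size_scale // size_prod_XsubC.
have rs_far r : r \in rs -> rho < normc r.
  move=> rrs; rewrite ltNge; apply/negP => /nz.
  by rewrite frs hornerZ mulf_eq0 negb_or -rootE root_prod_XsubC rrs andbF.
have rs0 r : r \in rs -> r != 0.
  by move=> /rs_far h; rewrite -normc_eq0 gt_eqF // (lt_trans rho0).
pose rs' := map (fun r : C => r^-1) rs.
have [p0 p2] := newton2_prod rs'.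
have fE : f = \prod_(r <- rs') (1 - r *: 'X).
  have [c cE] : exists c : C, f = c *: \prod_(r <- rs') (1 - r *: 'X).
    rewrite frs; exists (lead_coef f * \prod_(r <- rs) (- r)).
    rewrite -scalerA big_map -scaler_prod; congr (_ *: _).
    apply: eq_big_seq => r /rs0 r0.
    by rewrite scalerBr scalerA mulNr mulfV // scaleN1r opprK addrC alg_polyC polyCN.
  suff c1 : c = 1 by rewrite cE c1 scale1r.
  by rewrite -f0 cE coefZ p0 mulr1.
rewrite fE p2 big_map.
have -> : n%:R = \sum_(i < n) (1 : R) by rewrite sumr_const card_ord.
rewrite (@le_trans _ _ ((size rs)%:R)) //; last by rewrite sumr_const card_ord ler_nat.
elim: rs rs_far {frs srs rs0 rs' p0 p2 fE} => [|r rs IH] H.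
  by rewrite big_nil normc0 mulr0.
rewrite big_cons /= -[(size rs).+1]add1n natrD.
have rfar : rho < normc r by apply: H; rewrite inE eqxx.
have r0 : 0 < normc r by apply: lt_trans rfar.
rewrite (@le_trans _ _ (rho ^+ 2 * (normc (r^-1 ^+ 2) + normc (\sum_(i <- rs) i^-1 ^+ 2)))) //.
  by rewrite ler_wpM2l ?sqr_ge0 ?le_normcD.
rewrite mulrDr lerD //.
  rewrite normcX normcV exprVn ler_pdivrMr ?exprn_gt0 // mul1r.
  by rewrite lerXn2r ?nnegrE ?ltW.
by apply: IH => r' r'rs; apply: H; rewrite inE r'rs orbT.
Qed.

Section Functional.
Variables (B : CBanachAlg) (L : B -> C).
Hypothesis Llin : scalar L.

Lemma functional0 : L 0 = 0.
Proof. by have := Llin (-1) 0 0; rewrite scaler0 addr0 mulN1r addNr. Qed.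

Lemma functionalD x y : L (x + y) = L x + L y.
Proof. by have := Llin 1 x y; rewrite scale1r mul1r. Qed.

Lemma functionalZ (c : C) x : L (c *: x) = c * L x.
Proof. by have := Llin c x 0; rewrite !addr0 functional0 addr0. Qed.

Lemma functionalB x y : L (x - y) = L x - L y.
Proof. by rewrite functionalD -scaleN1r functionalZ mulN1r. Qed.

Lemma functional_sum (I : Type) (r : seq I) (F : I -> B) :
  L (\sum_(i <- r) F i) = \sum_(i <- r) L (F i).
Proof.
elim: r => [|i r IH]; first by rewrite !big_nil functional0.
by rewrite !big_cons functionalD IH.
Qed.

Definition power_poly (x : B) n : {poly C} :=
  \poly_(j < n.+1) ((-1) ^+ j * 'C(n, j)%:R * L (x ^+ j)).

Lemma horner_power_poly x n z : (power_poly x n).[z] = L ((1 - z *: x) ^+ n).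
Proof.
rewrite horner_poly subX_one_scale functional_sum.
by apply: eq_bigr => j _; rewrite !functionalZ mulrC.
Qed.

Lemma coef_power_poly x n j :
  (power_poly x n)`_j = (-1) ^+ j * 'C(n, j)%:R * L (x ^+ j).
Proof.
by rewrite coef_poly ltnS; case: leqP => // nj; rewrite bin_small // mulr0 mul0r.
Qed.

Hypothesis L1 : L 1 = 1.

(* The polynomial [z |-> L ((1 - z x)^n)] has no root in the disc of radius [rho],
   so the second power sum of its inverse roots, which is
   [n^2 L(x)^2 - n (n - 1) L(x^2)], is at most [n / rho^2]; let [n] grow. *)
Lemma functional_square (x : B) (rho : R) : 0 < rho ->
  (forall n z, normc z <= rho -> L ((1 - z *: x) ^+ n) != 0) ->
  L (x ^+ 2) = L x ^+ 2.
Proof.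
move=> rho0 H; set D := L x ^+ 2 - L (x ^+ 2).
suff D0 : normc D <= 0.
  have : normc D == 0 by rewrite eq_le D0 normc_ge0.
  by rewrite normc_eq0 subr_eq0 => /eqP.
pose c := (1 + rho ^+ 2 * normc (L (x ^+ 2))) / rho ^+ 2.
have bound n : n.+1%:R * normc D <= c.
  have n0 : 0 < n.+1%:R :> R by rewrite ltr0n.
  have := @power_sum2_bound (power_poly x n.+1) rho n.+1 rho0.
  rewrite !coef_power_poly bin0 bin1 !expr0 !expr1 L1 !mulr1 sqrrN expr1n mul1r.
  move=> /(_ erefl (size_poly _ _)) h; move: h.
  rewrite (_ : (-1 * n.+1%:R * L x) ^+ 2 - 2 * ('C(n.+1, 2)%:R * L (x ^+ 2)) =
      n.+1%:R * (n.+1%:R * D + L (x ^+ 2))); last first.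
    have : 2 * 'C(n.+1, 2)%:R = n.+1%:R * n%:R :> C.
      by rewrite -!natrM -mul_bin_diag bin1.
    by rewrite -[n.+1%:R]natr1 /D => E; rewrite [2 * (_ * _)]mulrA E; ring.
  have nz z : normc z <= rho -> (power_poly x n.+1).[z] != 0.
    by move=> zr; rewrite horner_power_poly H.
  move=> /(_ nz); move: nz => _.
  rewrite normcM normc_nat mulrCA -[leRHS]mulr1 ler_pM2l // => h.
  rewrite ler_pdivlMr ?exprn_gt0 //.
  have : normc (n.+1%:R * D) <= normc (n.+1%:R * D + L (x ^+ 2)) + normc (L (x ^+ 2)).
    by rewrite -{1}[_ * D](addrK (L (x ^+ 2))) (le_trans (le_normcD _ _)) // normcN.
  rewrite normcM normc_nat => h'.
  have := ler_wpM2l (sqr_ge0 rho) h'; lra.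
rewrite leNgt; apply/negP => D0.
have c0 : 0 <= c by rewrite divr_ge0 ?sqr_ge0 // addr_ge0 // mulr_ge0 ?sqr_ge0 ?normc_ge0.
have := bound (Num.bound (c / normc D)).
rewrite -ler_pdivlMr // leNgt => /negP; apply.
by rewrite (lt_le_trans (archi_boundP (divr_ge0 c0 (ltW D0)))) // ler_nat.
Qed.

(** Polarization gives only the symmetrized identity. If [L x = 0] and [w = y x y], then
    [(xy - yx)^2 + (xy + yx)^2 = 2 (xw + wx)] is sent to zero, hence [L (xy) = L (yx)]; their sum
    vanishes as well. The general case follows by subtracting [L x] from [x]. *)
Lemma functional_mul : (forall x, L (x ^+ 2) = L x ^+ 2) ->
  forall x y, L (x * y) = L x * L y.
Proof.
move=> sq.
have jordan x y : L (x * y) + L (y * x) = 2 * L x * L y.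
  have := sq (x + y); rewrite !expr2 mulrDl !mulrDr !functionalD.
  have := sq x; have := sq y; rewrite !expr2 => -> ->.
  move=> E; apply: (addrI (L x * L x + L y * L y)).
  by apply: etrans (etrans E _); ring.
have ker x y : L x = 0 -> L (x * y) = 0.
  move=> x0.
  have yx : L (y * x) = - L (x * y).
    by apply/eqP; rewrite -addr_eq0 addrC jordan x0 mulr0 mul0r.
  pose w := y * x * y.
  have E : (x * y - y * x) ^+ 2 + (x * y + y * x) ^+ 2 = 2%:R *: (x * w + w * x).
    have sqD (u v : B) : (u + v) ^+ 2 = (u * u + v * v) + (u * v + v * u).
      by rewrite expr2 mulrDl !mulrDr [v * u + _]addrC addrACA.
    rewrite !sqD mulrNN mulNr mulrN -opprD addrACA addNr addr0 -mulr2n scaler_nat.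
    by rewrite /w !mulrA.
  have := congr1 L E.
  rewrite functionalD !sq functionalZ [L (x * w + _)]functionalD jordan x0 mulr0 mul0r mulr0.
  rewrite functionalB functionalD yx subrr expr0n addr0 opprK -mulr2n.
  by move/eqP; rewrite sqrf_eq0 mulrn_eq0 => /orP[//|/eqP].
move=> x y.
have := ker (x - (L x)%:A) y.
rewrite functionalB functionalZ L1 mulr1 subrr mulrBl functionalB -scalerAl mul1r.
by rewrite functionalZ => /(_ erefl)/eqP; rewrite subr_eq0 => /eqP.
Qed.

End Functional.

Lemma horner_real_part (F : {poly C}) (t : R) :
  F.[t%:C] = (map_poly (@complex.Re R) F).[t] +i* (map_poly (@complex.Im R) F).[t].
Proof.
have E (g : C -> R) : g 0 = 0 ->
    (map_poly g F).[t] = \sum_(j < size F) g F`_j * t ^+ j.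
  move=> g0; rewrite (@horner_coef_wide _ (size F)) ?size_poly //.
  by apply: eq_bigr => j _; rewrite coef_map_id0.
rewrite !E // horner_coef.
elim/big_rec3: _ => // j u v w _ ->.
rewrite -rmorphXn /=; case: (F`_j) => a b.
by apply/eqP; rewrite eq_complex /= !mulr0 subr0 add0r !eqxx.
Qed.

Lemma normc_ltE (z w : C) : (normc z < normc w) =
  (complex.Re z ^+ 2 + complex.Im z ^+ 2 < complex.Re w ^+ 2 + complex.Im w ^+ 2).
Proof.
case: z w => a b [c d] /=.
by rewrite !ltNge ler_sqrt ?addr_ge0 ?sqr_ge0.
Qed.

Section RealGKZ.
Variables (B : CBanachAlg) (G : B -> Prop) (eps : R).
Hypothesis G1 : G 1.
Hypothesis GM : forall x y, G x -> G y -> G (x * y).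
Hypothesis eps0 : 0 < eps.
Hypothesis Gball : forall x, norm (x - 1) < eps -> G x.
Variables (L1 L2 : B -> C).
Hypothesis L1lin : scalar L1.
Hypothesis L2lin : scalar L2.
Hypothesis neq : forall g, G g -> normc (L1 g) != normc (L2 g).
Hypothesis lt1 : normc (L2 1) < normc (L1 1).

(** On the segment from [1] to [1 - z x] the [n]-th powers stay in [G], where the two moduli never
    agree. The squared moduli are real polynomials in the parameter, so by the intermediate value
    theorem the strict inequality at [1] persists. *)
Lemma dominance (x : B) n (z : C) : normc z * norm x < eps ->
  normc (L2 ((1 - z *: x) ^+ n)) < normc (L1 ((1 - z *: x) ^+ n)).
Proof.
move=> zx; rewrite ltNge; apply/negP => le.
set y := z *: x in le.
have Gt (t : R) : 0 <= t <= 1 -> G ((1 - t%:C *: y) ^+ n).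
  move=> /andP[t0 t1].
  have Gy : G (1 - t%:C *: y).
    apply: Gball; rewrite addrC addrA addNr add0r normN normZ normc_real ger0_norm //.
    by rewrite /y normZ (le_lt_trans _ zx) // ler_piMl ?mulr_ge0 ?normc_ge0 ?norm_ge0r.
  by elim: n {le} => [|m IH]; rewrite ?expr0 // exprS; apply: GM.
pose F1 := power_poly L1 y n; pose F2 := power_poly L2 y n.
pose sq (F : {poly C}) := map_poly (@complex.Re R) F ^+ 2 + map_poly (@complex.Im R) F ^+ 2.
pose P : {poly R} := sq F2 - sq F1.
have sqE F t : (sq F).[t] = complex.Re F.[t%:C] ^+ 2 + complex.Im F.[t%:C] ^+ 2.
  by rewrite horner_real_part /sq hornerD !horner_exp.
have FE1 t : F1.[t%:C] = L1 ((1 - t%:C *: y) ^+ n) by rewrite horner_power_poly.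
have FE2 t : F2.[t%:C] = L2 ((1 - t%:C *: y) ^+ n) by rewrite horner_power_poly.
have PE t : P.[t] =
    (complex.Re (L2 ((1 - t%:C *: y) ^+ n)) ^+ 2 + complex.Im (L2 ((1 - t%:C *: y) ^+ n)) ^+ 2)
  - (complex.Re (L1 ((1 - t%:C *: y) ^+ n)) ^+ 2 + complex.Im (L1 ((1 - t%:C *: y) ^+ n)) ^+ 2).
  by rewrite hornerD hornerN !sqE FE1 FE2.
have y0 : (1 - (0 : R)%:C *: y) ^+ n = 1 by rewrite rmorph0 scale0r subr0 expr1n.
have y1 : 1 - (1 : R)%:C *: y = 1 - y by rewrite rmorph1 scale1r.
have [||t tI] := @poly_ivt _ P 0 1; first exact: ler01.
  rewrite !PE y0 y1 subr_le0 subr_ge0.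
  by rewrite !leNgt -!normc_ltE -!leNgt le ltW.
rewrite rootE PE subr_eq0 => /eqP E.
have := neq (Gt t tI); rewrite neq_lt !normc_ltE E.
by rewrite ltxx.
Qed.

(* [L1] and [L2] are the linear part and the conjugate of the antilinear part of a
   real-linear functional, which vanishes at some [mu *: g] with [mu != 0] exactly
   when [normc (L1 g) = normc (L2 g)]. *)
Lemma real_gleason_kahane_zelazko : exists2 eta : B -> C, character eta &
  forall x, L1 x = L1 1 * eta x /\ L2 x = L2 1 * eta x.
Proof.
have c0 : L1 1 != 0 by rewrite -normc_eq0 gt_eqF // (le_lt_trans _ lt1) ?normc_ge0.
pose eta x := (L1 1)^-1 * L1 x.
have etalin : scalar eta.
  by move=> a x y; rewrite /eta L1lin mulrDr mulrCA.
have eta1 : eta 1 = 1 by rewrite /eta mulVf.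
have dom0 x n z : normc z * norm x < eps -> eta ((1 - z *: x) ^+ n) != 0.
  move=> /(@dominance _ n) h; rewrite mulf_neq0 ?invr_eq0 //.
  by rewrite -normc_eq0 gt_eqF // (le_lt_trans _ h) ?normc_ge0.
pose rho (x : B) := eps / (norm x + 1).
have rho0 x : 0 < rho x by rewrite divr_gt0 // ltr_wpDl ?norm_ge0r.
have rhoP x z : normc z <= rho x -> normc z * norm x < eps.
  move=> zr; have := norm_ge0r x => nx.
  rewrite (@le_lt_trans _ _ (rho x * norm x)) ?ler_wpM2r //.
  rewrite /rho mulrAC ltr_pdivrMr ?ltr_wpDl //.
  by rewrite ltr_pM2l // ltrDl.
have etasq x : eta (x ^+ 2) = eta x ^+ 2.
  by apply: (functional_square etalin eta1 (rho0 x)) => n z /rhoP/dom0.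
have etaM := functional_mul etalin eta1 etasq.
have etaX x n : eta (x ^+ n) = eta x ^+ n.
  by elim: n => [|n IH]; rewrite ?expr0 // !exprS etaM IH.
exists eta; first split => //.
  move=> x; rewrite leNgt; apply/negP => lt_eta.
  have e0 : 0 < normc (eta x) by rewrite (le_lt_trans _ lt_eta) ?norm_ge0r.
  (* Here [eta y = 1] and [norm y < 1]. For large [N] the element [1 - y^N] is so close to [1] that
     [dom0] applies, although [eta] annihilates it. *)
  pose y := (eta x)^-1 *: x.
  have etay : eta y = 1 by rewrite /y functionalZ // mulVf // -normc_eq0 gt_eqF.
  have ny : Rlt (Rabs (norm y)) 1.
    apply/RltP; rewrite RabsE ger0_norm ?norm_ge0r // normZ normcV.
    by rewrite mulrC ltr_pdivrMr // mul1r.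
  have eps0' : Rlt 0 eps by apply/RltP.
  have [N HN] := pow_lt_1_zero _ ny _ eps0'.
  have /RltP := HN N (PeanoNat.Nat.le_refl N).
  rewrite RabsE RpowE ger0_norm ?exprn_ge0 ?norm_ge0r // => lt_eps.
  have := dom0 (y ^+ N) 1%N 1.
  rewrite normc1 mul1r (le_lt_trans (normX_le _ _) lt_eps) => /(_ erefl).
  by rewrite expr1 scale1r functionalB // eta1 etaX etay expr1n subrr eqxx.
have L1E x : L1 x = L1 1 * eta x by rewrite /eta mulVKf.
move=> x; split=> //.
(* On the kernel of [eta] the dominating value [L1 ((1 - z y)^n)] equals [L1 1], so the bound on
   [L2] is uniform in [n] and the power bound gives [L2 y = 0]. *)
pose y := x - (eta x)%:A.
have etay : eta y = 0 by rewrite functionalB // functionalZ // eta1 mulr1 subrr.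
suff L2y : L2 y = 0.
  by move/eqP: L2y; rewrite functionalB // functionalZ // subr_eq0 mulrC => /eqP.
have etaP n z : eta ((1 - z *: y) ^+ n) = 1.
  by rewrite etaX functionalB // functionalZ // etay mulr0 subr0 eta1 expr1n.
have bound n : n%:R * rho y * normc (L2 y) <= normc (L1 1).
  apply: (@seminorm_power_bound B (fun v => normc (L2 v))).
  - by move=> u v; rewrite functionalD // le_normcD.
  - by move=> a u; rewrite functionalZ // normcM.
  - exact/ltW.
  move=> z zr; have := @dominance y n z; rewrite rhoP ?zr // => /(_ erefl)/ltW.
  by rewrite [L1 _]L1E etaP mulr1.
apply/eqP; rewrite -normc_eq0 eq_le normc_ge0 andbT leNgt; apply/negP => n0.
have p0 : 0 < rho y * normc (L2 y) by rewrite mulr_gt0.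
have := bound (Num.bound (normc (L1 1) / (rho y * normc (L2 y)))).
rewrite -mulrA -ler_pdivlMr // leNgt => /negP; apply.
by rewrite archi_boundP // divr_ge0 ?normc_ge0 ?ltW.
Qed.

End RealGKZ.

Lemma subrBB (V : zmodType) (s x y : V) : s - x - (s - y) = y - x.
Proof. by rewrite opprB addrC addrA subrK. Qed.

(** * The local Mazur-Ulam theorem *)

Lemma norm_half (A : CBanachAlg) (x : A) : norm (2^-1 *: x) = norm x / 2.
Proof. by rewrite normZ normcV (normc_nat 2) mulrC. Qed.

Lemma norm_double (A : CBanachAlg) (x : A) : norm (x + x) = 2 * norm x.
Proof. by rewrite -mulr2n -scaler_nat normZ normc_nat. Qed.

Lemma scale_half2 (A : CBanachAlg) (x : A) : 2^-1 *: x + 2^-1 *: x = x.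
Proof. by rewrite -scalerDl (_ : 2^-1 + 2^-1 = 1) ?scale1r //; field. Qed.

(* Väisälä's trick: conjugating the reflection by an isometry doubles the
   displacement of the centre, so on a bounded set there is no displacement. *)
Lemma isometry_fixes_center (A : CBanachAlg) (H : A -> Prop) (m : A) (D : R)
    (g h : A -> A) :
  H m -> (forall x, H x -> H (m + m - x)) -> (forall x, H x -> norm (x - m) <= D) ->
  (forall x, H x -> H (g x) /\ h (g x) = x) ->
  (forall x, H x -> H (h x) /\ g (h x) = x) ->
  (forall x y, H x -> H y -> norm (g x - g y) = norm (x - y)) ->
  g m = m.
Proof.
move=> Hm Hpsi HD gP hP iso.
have doubling k : forall g h : A -> A,
    (forall x, H x -> H (g x) /\ h (g x) = x) ->
    (forall x, H x -> H (h x) /\ g (h x) = x) ->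
    (forall x y, H x -> H y -> norm (g x - g y) = norm (x - y)) ->
    2 ^+ k * norm (g m - m) <= D.
  elim: k => [|k IH] {hP iso}g {gP}h gP hP iso.
    by rewrite expr0 mul1r HD //; case: (gP m).
  have isoh x y : H x -> H y -> norm (h x - h y) = norm (x - y).
    move=> Hx Hy; have [Hhx ghx] := hP x Hx; have [Hhy ghy] := hP y Hy.
    by rewrite -iso // ghx ghy.
  pose c x := h (m + m - g x).
  have cP x : H x -> H (c x) /\ c (c x) = x.
    move=> Hx; have [Hgx hgx] := gP x Hx.
    have [Hc gc] := hP _ (Hpsi _ Hgx).
    by split=> //; rewrite /c gc opprB addrC subrK.
  have isoc x y : H x -> H y -> norm (c x - c y) = norm (x - y).
    move=> Hx Hy; have [Hgx _] := gP x Hx; have [Hgy _] := gP y Hy.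
    rewrite isoh; [|exact: Hpsi|exact: Hpsi].
    by rewrite opprB addrC addrA subrK -iso // normB.
  have := IH c c cP cP isoc.
  have [Hgm _] := gP m Hm; have [Hcm gcm] := hP _ (Hpsi _ Hgm).
  rewrite -(iso (c m) m) // /c gcm.
  rewrite (_ : m + m - g m - g m = (m - g m) + (m - g m)); last by rewrite addrACA addrA.
  by rewrite norm_double normB exprSr mulrA.
apply/eqP; rewrite -subr_eq0; apply/eqP/norm_eq0r; rewrite leNgt; apply/negP => d0.
have D0 : 0 <= D by rewrite (le_trans _ (HD m Hm)) ?norm_ge0r.
have nD := archi_boundP (divr_ge0 D0 (ltW d0)).
set n := Num.bound _ in nD.
have := doubling n g h gP hP iso.
rewrite -ler_pdivlMr // leNgt => /negP; apply.
by rewrite (lt_le_trans nD) // -natrX ler_nat ltnW // ltn_expl.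
Qed.

Lemma subrDD (V : zmodType) (z x y : V) : z + x - (z + y) = x - y.
Proof. by rewrite opprD addrACA subrr add0r. Qed.

Lemma subDr (V : zmodType) (z x : V) : z + x - z = x.
Proof. by rewrite addrAC subrr add0r. Qed.

Definition real_linear_isometry (A B : CBanachAlg) (S : A -> B) : Prop :=
  [/\ forall x y, S (x + y) = S x + S y,
      forall (r : R) x, S (r%:C *: x) = r%:C *: S x,
      forall x, norm (S x) = norm x
    & forall y, exists x, S x = y].

(** For [r >= 0] the number [n r] exceeds some natural number by at most one. Hence [n] times the
    defect is at most [2 norm x] for every [n], and the defect vanishes. *)
Lemma additive_isometry_homogeneous (A B : CBanachAlg) (S : A -> B) :
  (forall x y, S (x + y) = S x + S y) -> (forall x, norm (S x) = norm x) ->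
  forall (r : R) x, S (r%:C *: x) = r%:C *: S x.
Proof.
move=> SD Siso.
have S0 : S 0 = 0 by apply: norm_eq0r; rewrite Siso norm0.
have SN x : S (- x) = - S x.
  by apply/eqP; rewrite -addr_eq0 -SD addNr S0.
have Sn n x : S (n%:R *: x) = n%:R *: S x.
  elim: n => [|n IH]; first by rewrite !scale0r S0.
  by rewrite -natr1 !scalerDl !scale1r SD IH.
have pos (r : R) x : 0 <= r -> S (r%:C *: x) = r%:C *: S x.
  move=> r0; apply/eqP; rewrite -subr_eq0; apply/eqP/norm_eq0r.
  rewrite leNgt; apply/negP => d0.
  set d := norm _ in d0.
  have bound n : n%:R * d <= 2 * norm x.
    have [m /andP[m1 m2]] : exists m : nat, m%:R <= n%:R * r < m%:R + 1.
      exists (Num.truncn (n%:R * r)); rewrite natr1.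
      by apply/andP; rewrite Num.Theory.truncn_le ?mulr_ge0 // Num.Theory.truncnS_gt.
    pose e := n%:R * r - m%:R.
    have e0 : 0 <= e by rewrite subr_ge0.
    have e1 : e <= 1 by rewrite lerBlDr addrC ltW.
    have nre : (n%:R * r)%:C = m%:R + e%:C :> C.
      by rewrite /e rmorphB /= rmorph_nat addrC subrK.
    rewrite -{1}normc_nat -normZ scalerBr -Sn scalerA -[n%:R * _](_ : (n%:R * r)%:C = _).
      rewrite nre scalerDl SD Sn scalerA.
      rewrite (_ : n%:R * r%:C = m%:R + e%:C) ?scalerDl; last first.
        by rewrite -nre rmorphM /= rmorph_nat.
      rewrite opprD addrACA subrr add0r (le_trans (normD _ _)) // normN.
      rewrite Siso !normZ Siso normc_real ger0_norm //.
      by have := norm_ge0r x; nra.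
    by rewrite rmorphM /= rmorph_nat.
  have x0 : 0 <= 2 * norm x / d by rewrite divr_ge0 ?mulr_ge0 ?norm_ge0r ?ltW.
  have := bound (Num.bound (2 * norm x / d)).
  by rewrite -ler_pdivlMr // leNgt archi_boundP.
move=> r x; have [r0|r0] := leP 0 r; first exact: pos.
rewrite -[r]opprK rmorphN /= scaleNr SN pos ?oppr_ge0 ?ltW //.
by rewrite scaleNr.
Qed.

Section LocalMazurUlam.
Variables (A B : CBanachAlg) (GA : A -> Prop) (GB : B -> Prop).
Variables (T : A -> B) (T' : B -> A).
Hypothesis openA : forall f, GA f ->
  exists2 e, 0 < e & forall x, norm (x - f) < e -> GA x.
Hypothesis openB : forall g, GB g ->
  exists2 e, 0 < e & forall y, norm (y - g) < e -> GB y.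
Hypothesis TG : forall f, GA f -> GB (T f).
Hypothesis T'G : forall g, GB g -> GA (T' g).
Hypothesis TK : forall f, GA f -> T' (T f) = f.
Hypothesis T'K : forall g, GB g -> T (T' g) = g.
Hypothesis Tiso : forall f g, GA f -> GA g -> norm (T f - T g) = norm (f - g).

(** Metric midpoints: a bounded set defined by distances alone, hence respected by isometries, and
    symmetric about the linear midpoint. *)
Definition equidistant (V : CBanachAlg) (a b x : V) : Prop :=
  norm (x - a) = norm (a - b) / 2 /\ norm (x - b) = norm (a - b) / 2.

Lemma equidistant_mid (V : CBanachAlg) (a b : V) :
  equidistant a b (2^-1 *: (a + b)).
Proof.
have E (u v : V) : 2^-1 *: (u + v) - u = 2^-1 *: (v - u).
  by rewrite -{2}[u]scale_half2 scalerDr scalerBr opprD addrACA subrr add0r.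
by split; last rewrite [a + b]addrC; rewrite E norm_half // normB.
Qed.

Lemma equidistant_refl (V : CBanachAlg) (a b x : V) :
  equidistant a b x -> equidistant a b (a + b - x).
Proof.
move=> [xa xb]; split.
  by rewrite [a + b]addrC addrAC addrK [LHS]normB.
by rewrite addrAC addrK [LHS]normB.
Qed.

(** The reflection in the midpoint of [T a] and [T b], pulled back through [T], is an isometric
    involution of the metric midpoints of [a] and [b], so it fixes the centre [m]. The two
    inclusions keep these sets within reach of [T] and [T']. *)
Lemma midpoint_preserved (a b : A) : GA a -> GA b ->
  (forall x, equidistant a b x -> GA x) ->
  (forall y, equidistant (T a) (T b) y -> GB y) ->
  T (2^-1 *: (a + b)) = 2^-1 *: (T a + T b).
Proof.
move=> Ga Gb subA subB.
set m := 2^-1 *: (a + b).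
have mm : m + m = a + b by apply: scale_half2.
have Hm : equidistant a b m := equidistant_mid a b.
have TH x : equidistant a b x -> equidistant (T a) (T b) (T x).
  by move=> Hx; have Gx := subA x Hx; rewrite /equidistant !Tiso.
have T'H y : equidistant (T a) (T b) y -> equidistant a b (T' y).
  move=> Hy; have Gy := subB y Hy; have GT'y := T'G Gy.
  by rewrite /equidistant -!Tiso // T'K.
pose g x := T' (T a + T b - T x).
have gP x : equidistant a b x -> equidistant a b (g x) /\ g (g x) = x.
  move=> Hx; have Hr := equidistant_refl (TH x Hx).
  split; first exact: T'H.
  by rewrite /g T'K ?TK ?opprB ?[_ + (_ - _)]addrC ?subrK ?TK; auto.
have gm : g m = m.
  apply: (@isometry_fixes_center A (equidistant a b) m (norm (a - b)) g g) => //.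
  - by move=> x Hx; rewrite mm; apply: equidistant_refl.
  - move=> x [xa _]; case: Hm => ma _.
    rewrite -(subrKA a) (le_trans (normD _ _)) // xa (normB a m) ma.
    by lra.
  move=> x y Hx Hy; rewrite -[LHS]Tiso ?/g; try by apply/T'G/subB/equidistant_refl/TH.
  rewrite !T'K; try by apply/subB/equidistant_refl/TH.
  by rewrite subrBB Tiso; [exact: normB|exact: subA|exact: subA].
have : T a + T b - T m = T m.
  by rewrite -{2}gm /g T'K //; apply/subB/equidistant_refl/TH.
by move=> /eqP; rewrite subr_eq => /eqP ->; rewrite scalerDr scale_half2.
Qed.

(** Preserving midpoints and zero, the displacement [D] is additive on a ball. The values
    [2^n D (x / 2^n)] are eventually constant in [n] and extend it to [S]; surjectivity is obtained
    by shrinking a target until [T'] applies near [T f]. *)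
Lemma locally_affine f : GA f -> exists2 r, 0 < r &
  exists2 S : A -> B, real_linear_isometry S &
    forall x, norm x < r -> T (f + x) = T f + S x.
Proof.
move=> Gf; have [e1 e10 ball1] := openA Gf; have [e2 e20 ball2] := openB (TG Gf).
(* Half the available radius, because metric midpoints of two points of the [r]-ball are only known
   to lie within [2 r] of its centre. *)
pose r := Num.min e1 e2 / 2.
have r0 : 0 < r by rewrite divr_gt0 // lt_min e10.
have re1 : r + r <= e1 by rewrite /r -splitr ge_min lexx.
have re2 : r + r <= e2 by rewrite /r -splitr ge_min lexx orbT.
have inG x : norm x < r -> GA (f + x).
  by move=> xr; apply: ball1; rewrite subDr; lra.
pose D x := T (f + x) - T f.
have Diso x y : norm x < r -> norm y < r -> norm (D x - D y) = norm (x - y).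
  move=> xr yr; rewrite /D opprB addrA subrK Tiso; [|exact: inG|exact: inG].
  by rewrite subrDD.
have D0 : D 0 = 0 by rewrite /D addr0 subrr.
have r00 : norm (0 : A) < r by rewrite norm0.
have Dn x : norm x < r -> norm (D x) = norm x.
  by move=> xr; rewrite -{1}[D x]subr0 -D0 Diso // subr0.
have Dmid x y : norm x < r -> norm y < r -> D (2^-1 *: (x + y)) = 2^-1 *: (D x + D y).
  move=> xr yr.
  have half : norm (x - y) / 2 < r.
    by have := normD x (- y); rewrite normN; lra.
  have E : f + 2^-1 *: (x + y) = 2^-1 *: ((f + x) + (f + y)).
    by rewrite addrACA [RHS]scalerDr [2^-1 *: (f + f)]scalerDr scale_half2.
  rewrite /D E midpoint_preserved; [|exact: inG|exact: inG| |].
  - by rewrite [in RHS]addrACA -opprD [RHS]scalerBr [2^-1 *: (T f + _)]scalerDr scale_half2.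
  - move=> z [zx _]; apply: ball1; apply: lt_le_trans re1.
    rewrite -(subrKA (f + x)) (le_lt_trans (normD _ _)) // zx.
    by rewrite subrDD subDr; lra.
  move=> z [zx _]; apply: ball2; apply: lt_le_trans re2.
  rewrite -(subrKA (T (f + x))) (le_lt_trans (normD _ _)) // zx.
  rewrite -/(D x) Dn // Tiso; [|exact: inG|exact: inG].
  by rewrite subrDD; lra.
have Dhalf x : norm x < r -> D (2^-1 *: x) = 2^-1 *: D x.
  by move=> xr; rewrite -{1}[x]addr0 Dmid // D0 addr0.
have DD x y : norm x < r -> norm y < r -> norm (x + y) < r -> D (x + y) = D x + D y.
  move=> xr yr xyr.
  have := Dhalf _ xyr; rewrite Dmid // => /(congr1 (fun z => z + z)).
  by rewrite !scale_half2.
pose c n : C := 2^-1 ^+ n.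
have c2 n : 2 ^+ n * c n = 1 by rewrite /c -exprMn mulfV ?expr1n ?pnatr_eq0.
have cn n x : norm (c n *: x : A) = norm x / 2 ^+ n.
  by rewrite normZ normcX normcV (normc_nat 2) exprVn mulrC.
have stable n x k : norm (c n *: x) < r ->
    2 ^+ (n + k) *: D (c (n + k)%N *: x) = 2 ^+ n *: D (c n *: x).
  move=> xr; elim: k => [|k IH]; first by rewrite addn0.
  have cS m : c m.+1 *: x = 2^-1 *: (c m *: x) by rewrite scalerA /c exprS.
  rewrite -IH addnS cS Dhalf.
    by rewrite scalerA exprSr mulfK ?pnatr_eq0.
  rewrite cn (le_lt_trans _ xr) // cn exprD invfM mulrA.
  by rewrite ler_piMr ?divr_ge0 ?norm_ge0r ?exprn_ge0 // invf_le1 ?exprn_gt0 // exprn_ege1 // ler1n.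
have large (x : A) : exists N, forall n, (N <= n)%N -> norm (c n *: x) < r.
  exists (Num.bound (norm x / r)) => n Nn.
  rewrite cn ltr_pdivrMr ?exprn_gt0 // mulrC -ltr_pdivrMr //.
  apply: (lt_le_trans (archi_boundP (divr_ge0 (norm_ge0r x) (ltW r0)))).
  by rewrite -natrX ler_nat (leq_trans Nn) // ltnW // ltn_expl.
have exS x : exists y, exists N, forall n, (N <= n)%N -> 2 ^+ n *: D (c n *: x) = y.
  have [N HN] := large x; exists (2 ^+ N *: D (c N *: x)), N => n /subnKC <-.
  by apply: stable; apply: HN.
have [S SP] := choice exS.
have SDr x : norm x < r -> S x = D x.
  move=> xr; have [N HN] := SP x; rewrite -(HN N (leqnn _)).
  by have := stable 0 x N; rewrite /c !expr0 !scale1r; apply.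
have Sadd x y : S (x + y) = S x + S y.
  have [N1 H1] := SP x; have [N2 H2] := SP y; have [N3 H3] := SP (x + y).
  have [N4 H4] := large x; have [N5 H5] := large y; have [N6 H6] := large (x + y).
  pose N := (N1 + N2 + N3 + N4 + N5 + N6)%N.
  rewrite -(H1 N) -?(H2 N) -?(H3 N); try by rewrite /N; lia.
  apply: etrans (scalerDr _ _ _); congr (_ *: _).
  rewrite scalerDr DD //; [apply: H4|apply: H5|rewrite -scalerDr; apply: H6].
  - by rewrite /N; lia.
  - by rewrite /N; lia.
  by rewrite /N; lia.
have Snorm x : norm (S x) = norm x.
  have [N1 H1] := SP x; have [N2 H2] := large x.
  rewrite -(H1 (N1 + N2)%N); last by lia.
  rewrite normZ Dn; last by apply: H2; lia.
  by rewrite -normZ scalerA c2 scale1r.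
have Shom := additive_isometry_homogeneous Sadd Snorm.
exists r => //; exists S; last by move=> x /SDr ->; rewrite /D [RHS]addrC subrK.
split=> // y.
have [n ny] : exists n : nat, norm y / 2 ^+ n < r.
  exists (Num.bound (norm y / r)).
  rewrite ltr_pdivrMr ?exprn_gt0 // mulrC -ltr_pdivrMr //.
  apply: (lt_le_trans (archi_boundP (divr_ge0 (norm_ge0r y) (ltW r0)))).
  by rewrite -natrX ler_nat ltnW // ltn_expl.
have cy : norm (c n *: y) < r by rewrite normZ normcX normcV (normc_nat 2) exprVn mulrC.
have Gy : GB (T f + c n *: y) by apply: ball2; rewrite subDr; lra.
pose x := T' (T f + c n *: y) - f.
have fx : f + x = T' (T f + c n *: y) by rewrite /x addrC subrK.
have xr : norm x < r.
  by rewrite -Tiso ?T'K //; [rewrite subDr|exact: T'G].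
exists ((2 ^+ n : R)%:C *: x).
rewrite Shom SDr // /D fx T'K // subDr scalerA.
by rewrite rmorphXn /= rmorph_nat c2 scale1r.
Qed.

End LocalMazurUlam.

(** * From local to global *)

Lemma interval_locally_constant (P : R -> Prop) :
  P 0 ->
  (forall s, 0 <= s <= 1 -> exists2 d, 0 < d &
     forall s', 0 <= s' <= 1 -> `|s' - s| < d -> (P s' <-> P s)) ->
  P 1.
Proof.
move=> P0 H; apply: contrapT => nP1.
pose E : set R := fun s => 0 <= s <= 1 /\ forall u, 0 <= u <= s -> P u.
have E0 : E 0.
  split; first by rewrite lexx ler01.
  by move=> u /andP[u0 u0']; rewrite (_ : u = 0) //; apply/eqP; rewrite eq_le u0 u0'.
have supE : has_sup E.
  by split; [exists 0|exists 1 => s [/andP[]]].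
pose m := reals.sup E.
have m0 : 0 <= m by apply: ub_le_sup E0; case: supE.
have m1 : m <= 1 by apply: ge_sup; [case: supE|move=> s [/andP[]]].
have [|d d0 dP] := H m; first by rewrite m0.
have [e [/andP[e0 e1] eP] me] := sup_adherent d0 supE.
have em : e <= m by apply: ub_le_sup; [case: supE|split; rewrite ?e0].
have Pm : P m.
  apply/(dP e); rewrite ?e0 //; last by apply: eP; rewrite e0 lexx.
  by rewrite ler0_norm ?subr_le0 // -/m in me *; lra.
pose m' := Num.min (m + d / 2) 1.
have m'1 : m' <= 1 by rewrite ge_min lexx orbT.
have m'd : m' < m + d by rewrite gt_min; apply/orP; left; lra.
have mm' : m <= m' by rewrite le_min m1 andbT; lra.
have Em' : E m'.
  split=> [|u /andP[u0 um']]; first by rewrite m'1 andbT; lra.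
  have [ue|eu] := leP u e; first by apply: eP; rewrite u0.
  apply/dP => //; first by rewrite u0; lra.
  by rewrite ltr_norml -/m in me *; apply/andP; split; lra.
have m'm : m' <= m by apply: ub_le_sup Em'; case: supE.
have [mlt|mge] := ltP m 1.
  by have : m < m'; [rewrite lt_min mlt andbT; lra|rewrite ltNge m'm].
by apply: nP1; rewrite (_ : 1 = m) //; apply/eqP; rewrite eq_le mge m1.
Qed.

Lemma segment_dist (A : CBanachAlg) (f g : A) (s s' : R) :
  norm ((f + s'%:C *: (g - f)) - (f + s%:C *: (g - f))) = `|s' - s| * norm (g - f).
Proof. by rewrite subrDD -scalerBl -rmorphB normZ normc_real. Qed.

(** The segment from [1] to [m] meets zero only when [m] is a nonpositive real; negative reals are
    reached in two segments through [i]. *)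
Lemma nonzero_scalar_hop (Q : C -> Prop) :
  Q 1 ->
  (forall l m : C, (forall s : R, 0 <= s <= 1 -> l + s%:C * (m - l) != 0) -> Q l -> Q m) ->
  forall m : C, m != 0 -> Q m.
Proof.
move=> Q1 hop.
have direct m : (complex.Im m != 0) || (0 < complex.Re m) -> Q m.
  move=> hm; apply: (hop 1) => // s /andP[s0 s1]; apply/eqP; case: m hm => a b /= hm.
  move=> E; have /= E1 := congr1 (@complex.Re R) E; have /= E2 := congr1 (@complex.Im R) E.
  case/orP: hm => [b0|a0]; last by nra.
  have /eqP : s * b = 0 by lra.
  by rewrite mulf_eq0 (negPf b0) orbF => /eqP s00; move: E1; rewrite s00; lra.
move=> m m0; have [hm|] := boolP ((complex.Im m != 0) || (0 < complex.Re m)).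
  exact: direct.
rewrite negb_or negbK => /andP[/eqP b0 _].
apply: (hop 'i%C); last by apply: direct; rewrite /= oner_eq0.
move=> s _; apply/eqP; case: m m0 b0 => a b /= m0 b0.
move=> E; have /= E1 := congr1 (@complex.Re R) E; have /= E2 := congr1 (@complex.Im R) E.
have s1 : s = 1 by move: E2; rewrite b0; lra.
move: m0; rewrite eq_complex /= b0 eqxx andbT => /eqP; apply.
by move: E1; rewrite s1; lra.
Qed.

(** * Scalars and cones in an open subgroup *)

Section OpenGroup.
Variables (A : CBanachAlg) (G : A -> Prop) (eps : R).
Hypothesis G1 : G 1.
Hypothesis GM : forall x y, G x -> G y -> G (x * y).
Hypothesis GV : forall x y, G x -> x * y = 1 -> y * x = 1 -> G y.
Hypothesis eps0 : 0 < eps.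
Hypothesis Gball : forall x, norm (x - 1) < eps -> G x.

(** The quotient of two neighbouring scalars on a segment avoiding zero lies in the ball about [1],
    so membership is locally constant along the segment. *)
Lemma scalar_in_group (m : C) : m != 0 -> G m%:A.
Proof.
apply: (nonzero_scalar_hop (Q := fun m => G m%:A)); first by rewrite scale1r.
move=> l {}m nz Gl.
pose p (s : R) := l + s%:C * (m - l).
rewrite (_ : m = p 1); last by rewrite /p mul1r addrC subrK.
apply: (@interval_locally_constant (fun s => G (p s)%:A)).
  by rewrite /p mul0r addr0.
move=> s sI; have ps0 := nz s sI; rewrite -/(p s) in ps0.
have nps : 0 < normc (p s) by rewrite lt_neqAle normc_ge0 eq_sym normc_eq0 ps0.
exists (eps * normc (p s) / (normc (m - l) + 1)).
  by rewrite divr_gt0 ?mulr_gt0 // ltr_wpDl ?normc_ge0.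
move=> s' s'I ds; have ps'0 := nz s' s'I; rewrite -/(p s') in ps'0.
pose v := p s' / p s.
have v0 : v != 0 by rewrite mulf_neq0 ?invr_eq0.
have Gv : G v%:A.
  apply: Gball; rewrite -[X in _ - X]scale1r -scalerBl normZ norm1 mulr1.
  have -> : v - 1 = (s' - s)%:C * (m - l) / p s.
    by rewrite /v -(divff ps0) -mulrBl /p subrDD rmorphB -mulrBl.
  rewrite !normcM normcV normc_real ltr_pdivrMr //.
  move: ds; rewrite ltr_pdivlMr ?ltr_wpDl ?normc_ge0 //.
  by have := normc_ge0 (m - l); have := normr_ge0 (s' - s); nra.
have Gv' : G v^-1%:A.
  by apply: (GV Gv); rewrite -scalerAl mul1r scalerA ?mulfV ?mulVf ?scale1r.
split=> Gp.
  rewrite (_ : (p s)%:A = (p s')%:A * v^-1%:A); first exact: GM.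
  by rewrite -scalerAl mul1r scalerA /v invf_div mulrC divfK.
rewrite (_ : (p s')%:A = (p s)%:A * v%:A); first exact: GM.
by rewrite -scalerAl mul1r scalerA /v mulrC divfK.
Qed.

Lemma scale_in_group (m : C) x : m != 0 -> G x -> G (m *: x).
Proof.
by move=> m0 Gx; rewrite -mulr_algl; apply: GM => //; apply: scalar_in_group.
Qed.

Lemma near_scalar_in_group (m : C) a : norm a < eps * normc m -> G (m%:A + a).
Proof.
move=> small; have m0 : m != 0.
  by apply/eqP => m0; move: small; rewrite m0 normc0 mulr0 ltNge norm_ge0r.
have nm : 0 < normc m by rewrite lt_neqAle normc_ge0 eq_sym normc_eq0 m0.
have -> : m%:A + a = m *: (1 + m^-1 *: a).
  by rewrite scalerDr scalerA mulfV // scale1r.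
apply: scale_in_group => //; apply: Gball.
by rewrite subDr normZ normcV mulrC ltr_pdivrMr.
Qed.

Lemma group_open f : G f -> (exists y, f * y = 1 /\ y * f = 1) ->
  exists2 e, 0 < e & forall x, norm (x - f) < e -> G x.
Proof.
move=> Gf [y [fy yf]].
exists (eps / (norm y + 1)); first by rewrite divr_gt0 // ltr_wpDl ?norm_ge0r.
move=> x xf; have -> : x = f * (y * x) by rewrite mulrA fy mul1r.
apply: GM => //; apply: Gball; rewrite -yf -mulrBr.
rewrite (le_lt_trans (normM_le _ _)) //.
move: xf; rewrite ltr_pdivlMr ?ltr_wpDl ?norm_ge0r //.
by have := norm_ge0r y; have := norm_ge0r (x - f); nra.
Qed.

End OpenGroup.

Definition affine_near (A B : CBanachAlg) (T S : A -> B) (w : B) (p : A) : Prop :=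
  exists2 r, 0 < r & forall x, norm (x - p) < r -> T x = S x + w.

Section RealLinearIsometry.
Variables (A B : CBanachAlg) (S : A -> B).
Hypothesis SP : real_linear_isometry S.

Lemma rliD x y : S (x + y) = S x + S y.
Proof. by case: SP. Qed.

Lemma rliZ (r : R) x : S (r%:C *: x) = r%:C *: S x.
Proof. by case: SP. Qed.

Lemma rliB x y : S (x - y) = S x - S y.
Proof. by rewrite rliD -scaleN1r -(rmorphN1 (real_complex R)) rliZ rmorphN1 scaleN1r. Qed.

Lemma rli_norm x : norm (S x) = norm x.
Proof. by case: SP. Qed.

Lemma rli_inj x y : S x = S y -> x = y.
Proof.
move=> E; apply/eqP; rewrite -subr_eq0; apply/eqP/norm_eq0r.
by rewrite -rli_norm rliB E subrr norm0.
Qed.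

End RealLinearIsometry.

Lemma affine_near_unique (A B : CBanachAlg) (T S S' : A -> B) (w w' : B) (p : A) :
  real_linear_isometry S -> real_linear_isometry S' ->
  affine_near T S w p -> affine_near T S' w' p ->
  forall x, S x + w = S' x + w'.
Proof.
move=> SP S'P [r r0 H] [r' r'0 H'] x.
have near v : norm v < Num.min r r' -> S (p + v) + w = S' (p + v) + w'.
  by rewrite lt_min => /andP[h h']; rewrite -H -?H' // subDr.
have Ep : S p + w = S' p + w'.
  by have := near 0; rewrite addr0 norm0 lt_min r0 r'0 => /(_ erefl).
pose v := x - p.
have v0 := norm_ge0r v.
pose t := Num.min r r' / (norm v + 1).
have t0 : 0 < t by rewrite divr_gt0 ?lt_min ?r0 // ltr_wpDl.
have small : norm (t%:C *: v) < Num.min r r'.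
  rewrite normZ normc_real ger0_norm ?ltW // /t mulrAC ltr_pdivrMr ?ltr_wpDl //.
  by rewrite ltr_pM2l ?lt_min ?r0 // ltrDl.
have := near _ small; rewrite rliD // [X in _ = X + _]rliD // !(addrAC _ _ w) !(addrAC _ _ w') Ep.
move=> /addrI; rewrite rliZ // [RHS]rliZ // => /scalerI Ev.
have tC : t%:C != 0 by rewrite -normc_eq0 normc_real normr_eq0 gt_eqF.
have {}Ev := Ev tC.
have -> : x = p + v by rewrite /v addrC subrK.
by rewrite rliD // [X in _ = X + _]rliD // !(addrAC _ _ w) !(addrAC _ _ w') Ep Ev.
Qed.

(** * Propagation of the affine form through the group *)

Section Globalization.
Variables (A B : CBanachAlg) (GA : A -> Prop) (eps : R).
Hypothesis G1 : GA 1.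
Hypothesis GM : forall x y, GA x -> GA y -> GA (x * y).
Hypothesis GV : forall x y, GA x -> x * y = 1 -> y * x = 1 -> GA y.
Hypothesis eps0 : 0 < eps.
Hypothesis Gball : forall x, norm (x - 1) < eps -> GA x.
Variable (T : A -> B).
Hypothesis Tiso : forall f g, GA f -> GA g -> norm (T f - T g) = norm (f - g).
Hypothesis Taff : forall f, GA f ->
  exists S w, real_linear_isometry S /\ affine_near T S w f.

(** Points close to each other on the segment share a ball on which [T] is affine, and an affine map
    is determined by its values on any ball, so the pair [S], [w] is carried along. *)
Lemma affine_along_segment (S : A -> B) (w : B) (f g : A) :
  real_linear_isometry S ->
  (forall s : R, 0 <= s <= 1 -> GA (f + s%:C *: (g - f))) ->
  affine_near T S w f -> affine_near T S w g.
Proof.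
move=> SP seg near.
pose p (s : R) := f + s%:C *: (g - f).
rewrite (_ : g = p 1); last by rewrite /p scale1r addrC subrK.
apply: (@interval_locally_constant (fun s => affine_near T S w (p s))).
  by rewrite /p scale0r addr0.
move=> s sI; have [S' [w' [S'P [r r0 H]]]] := Taff (seg s sI).
have d0 := norm_ge0r (g - f).
have dp : 0 < norm (g - f) + 1 by lra.
exists (r / 2 / (norm (g - f) + 1)); first by rewrite !divr_gt0.
move=> s' s'I; rewrite ltr_pdivlMr // => ds.
have pp : norm (p s' - p s) < r / 2.
  by rewrite segment_dist; have := normr_ge0 (s' - s); nra.
have near' : affine_near T S' w' (p s').
  exists (r / 2); first by lra.
  move=> x xr; apply: H; rewrite -(subrKA (p s')) (le_lt_trans (normD _ _)) //.
  by rewrite -/(p s); lra.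
have near0 : affine_near T S' w' (p s) by exists r.
split=> nearS.
  have E := affine_near_unique SP S'P nearS near'.
  by exists r => // x xr; rewrite E H.
have E := affine_near_unique SP S'P nearS near0.
by case: near' => r' r'0 H'; exists r' => // x xr; rewrite E H'.
Qed.

(** Continuation from [1] to [m] through nonzero scalars, then along the segment from [m] to
    [m + a], which stays in the cone. *)
Lemma affine_near_scalars (S : A -> B) (w : B) : real_linear_isometry S ->
  affine_near T S w 1 ->
  forall (m : C) a, norm a < eps * normc m -> affine_near T S w (m%:A + a).
Proof.
move=> SP near1 m a small.
have m0 : m != 0.
  by apply/eqP => m0; move: small; rewrite m0 normc0 mulr0 ltNge norm_ge0r.
apply: (@affine_along_segment _ _ m%:A) => //.
  move=> s /andP[s0 s1]; rewrite subDr.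
  apply: (near_scalar_in_group G1 GM GV eps0 Gball).
  rewrite normZ normc_real ger0_norm // (le_lt_trans _ small) //.
  by rewrite ler_piMl ?norm_ge0r.
move: m m0 {small}; apply: nonzero_scalar_hop; first by rewrite scale1r.
move=> l m nz; apply: affine_along_segment => // s sI.
rewrite -scalerBl scalerA -scalerDl.
exact: (scalar_in_group G1 GM GV eps0 Gball (nz s sI)).
Qed.

Lemma common_constant (S S' : A -> B) (w w' : B) f : GA f ->
  real_linear_isometry S -> real_linear_isometry S' ->
  affine_near T S w 1 -> affine_near T S' w' f ->
  (forall t : R, 0 < t -> T (t%:C *: f) = S' (t%:C *: f) + w') /\ w' = w.
Proof.
move=> Gf SP S'P near1 nearf.
have tC (t : R) : 0 < t -> t%:C != 0.
  by move=> t0; rewrite -normc_eq0 normc_real normr_eq0 gt_eqF.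
have Gt (t : R) x : 0 < t -> GA x -> GA (t%:C *: x).
  by move=> /tC; apply: (scale_in_group G1 GM GV eps0 Gball).
have Tt (t : R) : 0 < t -> T (t%:C *: f) = S' (t%:C *: f) + w'.
  move=> t0; have : affine_near T S' w' (t%:C *: f).
    apply: (affine_along_segment S'P _ nearf) => s /andP[s0 s1].
    have -> : f + s%:C *: (t%:C *: f - f) = (1 + s * (t - 1))%:C *: f.
      by rewrite rmorphD rmorphM rmorphB rmorph1 scalerDl -scalerA scalerBl scale1r.
    by apply: Gt => //=; nra.
  by case=> r r0; apply; rewrite subrr norm0.
have T1 (t : R) : 0 < t -> T (t%:C *: 1) = S (t%:C *: 1) + w.
  move=> t0; have [|r r0] := affine_near_scalars SP near1 (m := t%:C) (a := 0).
    by rewrite norm0 mulr_gt0 // normc_real normr_gt0 gt_eqF.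
  by rewrite addr0; apply; rewrite subrr norm0.
split=> //; apply/eqP; rewrite -subr_eq0; apply/eqP/norm_eq0r.
set d := norm _; rewrite leNgt; apply/negP => d0.
pose K := norm (f - 1) + norm (S' f) + norm (S 1).
have K0 : 0 <= K by rewrite !addr_ge0 ?norm_ge0r.
have bound (t : R) : 0 < t -> d <= t * K.
  move=> t0; have := Tiso (Gt t f t0 Gf) (Gt t 1 t0 G1).
  rewrite Tt // T1 // -scalerBr normZ normc_real gtr0_norm // => E.
  have -> : d = norm ((S' (t%:C *: f) + w' - (S (t%:C *: 1) + w))
                      - t%:C *: S' f + t%:C *: S 1).
    rewrite /d (rliZ S'P) (rliZ SP) opprD addrACA; congr norm.
    move: (t%:C *: S' f) (t%:C *: S 1) (w' - w) => a b c.
    by rewrite (addrAC (a - b + c)) (addrAC (a - b)) subrK subDr.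
  rewrite (le_trans (normD _ _)) // (le_trans (lerD (normD _ _) (lexx _))) //.
  rewrite E normN !normZ normc_real gtr0_norm // /K !mulrDr; lra.
have := bound (d / (2 * (K + 1))); rewrite divr_gt0 // => [/(_ erefl)|]; last by lra.
rewrite mulrAC ler_pdivlMr; last by lra.
nra.
Qed.

Lemma globally_affine : exists S w,
  real_linear_isometry S /\ forall f, GA f -> T f = S f + w.
Proof.
have [S [w [SP near1]]] := Taff G1.
exists S, w; split=> // f Gf.
have [S' [w' [S'P nearf]]] := Taff Gf.
have [Tt w'E] := common_constant Gf SP S'P near1 nearf.
have [h hE] : exists h, S h = S' f - S f by case: SP => _ _ _; apply.
pose t := eps / (2 * (norm f + 1)).
have nf := norm_ge0r f.
have t0 : 0 < t by rewrite divr_gt0 // mulr_gt0 // ltr_wpDl.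
have tf : norm (t%:C *: f) < eps.
  rewrite normZ normc_real gtr0_norm // /t mulrAC ltr_pdivrMr; last by lra.
  by rewrite ltr_pM2l //; lra.
suff h0 : h = 0.
  have := Tt 1 ltr01; rewrite scale1r w'E => ->; congr (_ + _).
  have S0 : S 0 = 0 by apply: norm_eq0r; rewrite (rli_norm SP) norm0.
  by move/eqP: hE; rewrite h0 S0 eq_sym subr_eq0 => /eqP.
apply: (@isometric_perturbation_eq0 A h t) => // z zt.
have z0 : z != 0 by rewrite -normc_eq0 zt gt_eqF.
(* As [l] is unimodular, [l + t f] lies in the cone, where [T = S + w]. Comparing it with [t f],
   where [T = S' + w], gives [norm (l - t h) = 1], and [l - t h = l (1 - z h)]. *)
pose l : C := t%:C / z.
have nl : normc l = 1.
  by rewrite /l normcM normcV zt normc_real gtr0_norm // mulfV // gt_eqF.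
have small : norm (t%:C *: f) < eps * normc l by rewrite nl mulr1.
have Gl := near_scalar_in_group G1 GM GV eps0 Gball small.
have Gtf : GA (t%:C *: f).
  apply: (scale_in_group G1 GM GV eps0 Gball) => //.
  by rewrite -normc_eq0 normc_real normr_eq0 gt_eqF.
have [r r0 near] := affine_near_scalars SP near1 small.
have := Tiso Gl Gtf.
rewrite near ?subrr ?norm0 // Tt // w'E -addrA opprD.
rewrite [w + _]addrC subrK addrK normZ nl norm1 mulr1 => E.
have S'E : S' (t%:C *: f) = S (t%:C *: (f + h)).
  by rewrite (rliZ S'P) (rliZ SP) (rliD SP) hE addrC subrK.
have : norm (l%:A - t%:C *: h) = 1.
  rewrite -(rli_norm SP) -[RHS]E S'E -(rliB SP); congr (norm (S _)).
  by rewrite scalerDr opprD addrA addrK.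
have -> : l%:A - t%:C *: h = l *: (1 - z *: h).
  by rewrite scalerBr scalerA /l divfK.
by rewrite normZ nl mul1r => ->.
Qed.

End Globalization.

(** * Multiplicativity *)

Lemma normc_sqr (z : C) : z * conjc z = (normc z ^+ 2)%:C.
Proof.
case: z => a b; rewrite /= sqr_sqrtr ?addr_ge0 ?sqr_ge0 //.
by apply/eqP; rewrite eq_complex /=; apply/andP; split; apply/eqP; ring.
Qed.

Lemma normc_conj (z : C) : normc (conjc z) = normc z.
Proof. by case: z => a b /=; rewrite sqrrN. Qed.

Lemma conjM (z w : C) : conjc (z * w) = conjc z * conjc w.
Proof. exact: rmorphM. Qed.

Lemma conjD (z w : C) : conjc (z + w) = conjc z + conjc w.
Proof. exact: rmorphD. Qed.

(** The squared modulus is [(|a|^2 + |k|^2) |w|^2 + 2 Re (a k w^2)]; the values [w = 1], [i] and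
    [1 + i] isolate the real and imaginary parts of [a k]. *)
Lemma isometric_real_linear_plane (a k : C) :
  (forall w, normc (a * w + conjc (k * w)) = normc w) -> a * k = 0.
Proof.
move=> H.
have sq w : normc (a * w + conjc (k * w)) ^+ 2 = normc w ^+ 2 by rewrite H.
have := sq 1; have := sq 'i%C; have := sq (1 +i* 1).
case: a k {H sq} => a b [c d] /=.
rewrite !sqr_sqrtr ?addr_ge0 ?sqr_ge0 // => E1 E2 E3.
by apply/eqP; rewrite eq_complex /=; apply/andP; split; apply/eqP; lra.
Qed.

(** * Complex-linear and antilinear parts of a real-linear functional *)

Section RealLinearParts.
Variables (B : CBanachAlg) (psi : B -> C).
Hypothesis psiD : forall x y, psi (x + y) = psi x + psi y.
Hypothesis psiZ : forall (r : R) x, psi (r%:C *: x) = r%:C * psi x.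

Definition linear_part x : C := (psi x - 'i%C * psi ('i%C *: x)) / 2.
(** Conjugated, so that both parts are complex linear and can play symmetric roles. *)
Definition antilinear_part x : C := conjc ((psi x + 'i%C * psi ('i%C *: x)) / 2).

Lemma parts_sum x : psi x = linear_part x + conjc (antilinear_part x).
Proof. by rewrite /linear_part /antilinear_part conjcK; field. Qed.

Lemma real_linear_scale (a b : R) x :
  psi ((a +i* b) *: x) = a%:C * psi x + b%:C * psi ('i%C *: x).
Proof.
have -> : a +i* b = a%:C + b%:C * 'i%C.
  by apply/eqP; rewrite eq_complex /=; apply/andP; split; apply/eqP; ring.
by rewrite scalerDl -scalerA psiD !psiZ.
Qed.

Lemma real_linear_scale_i (a b : R) x :
  psi ('i%C *: ((a +i* b) *: x)) = - b%:C * psi x + a%:C * psi ('i%C *: x).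
Proof.
have -> : 'i%C *: ((a +i* b) *: x) = ((- b) +i* a) *: x.
  rewrite scalerA; congr (_ *: _).
  by apply/eqP; rewrite eq_complex /=; apply/andP; split; apply/eqP; ring.
by rewrite real_linear_scale rmorphN.
Qed.

Lemma i_squared : 'i%C * 'i%C = -1 :> C.
Proof. by rewrite -expr2 sqr_i. Qed.

Lemma complex_coords (a b : R) : a +i* b = a%:C + 'i%C * b%:C :> C.
Proof.
by apply/eqP; rewrite eq_complex /=; apply/andP; split; apply/eqP; ring.
Qed.

Lemma linear_part_scalar : scalar linear_part.
Proof.
move=> [a b] x y; rewrite /linear_part scalerDr !psiD.
rewrite real_linear_scale real_linear_scale_i (complex_coords a b).
have := i_squared.
move: ('i%C) (psi x) (psi y) (psi ('i%C *: x)) (psi ('i%C *: y)) => i px py pix piy ii.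
apply/eqP; rewrite -subr_eq0 (_ : _ - _ = (i * i + 1) * (b%:C * pix / 2)); last by field.
by rewrite ii addrC subrr mul0r.
Qed.

Lemma antilinear_part_scalar : scalar antilinear_part.
Proof.
move=> c x y; rewrite /antilinear_part -[c in RHS]conjcK -conjM -conjD; congr conjc.
case: c => a b; rewrite scalerDr !psiD real_linear_scale real_linear_scale_i.
have -> : conjc (a +i* b) = a%:C - 'i%C * b%:C.
  by rewrite -mulrN -rmorphN /= -complex_coords.
have := i_squared.
move: ('i%C) (psi x) (psi y) (psi ('i%C *: x)) (psi ('i%C *: y)) => i px py pix piy ii.
apply/eqP; rewrite -subr_eq0 (_ : _ - _ = (i * i + 1) * (b%:C * pix / 2)); last by field.
by rewrite ii addrC subrr mul0r.
Qed.

Lemma real_linear_partsE (mu : C) x :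
  psi (mu *: x) = mu * linear_part x + conjc mu * conjc (antilinear_part x).
Proof.
by rewrite parts_sum (functionalZ linear_part_scalar)
  (functionalZ antilinear_part_scalar) conjM.
Qed.

(** For [|a| = |b|] the equation [mu a + conj mu b = 0] has a nonzero solution: [1] if [a = 0], [i]
    if [a = b], and [1 - b / a] otherwise. *)
Lemma parts_norm_neq x :
  (forall mu, mu != 0 -> psi (mu *: x) != 0) ->
  normc (linear_part x) != normc (antilinear_part x).
Proof.
move=> nz; apply/eqP => E.
set a := linear_part x in E; set b := conjc (antilinear_part x).
have {}E : normc a = normc b by rewrite normc_conj.
have [a0|a0] := eqVneq a 0.
  have := nz 1 (oner_neq0 _); rewrite real_linear_partsE -/a -/b.
  have -> : b = 0 by apply/eqP; rewrite -normc_eq0 -E a0 normc0.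
  by rewrite a0 !mulr0 addr0 eqxx.
have [ba|ba] := eqVneq b a.
  have i0 : 'i%C != 0 :> C by rewrite eq_complex /= oner_eq0 andbF.
  have := nz 'i%C i0; rewrite real_linear_partsE -/a -/b ba -mulrDl.
  by rewrite (_ : 'i%C + conjc 'i%C = 0) ?mul0r ?eqxx //; apply/eqP;
    rewrite eq_complex /= addr0 subrr eqxx.
have mu0 : 1 - b / a != 0.
  by rewrite subr_eq0 eq_sym; apply: contra ba => /eqP h; rewrite -(divfK a0 b) h mul1r.
have ca0 : conjc a != 0 by rewrite conjc_eq0.
have := nz _ mu0; rewrite real_linear_partsE -/a -/b => /eqP; apply.
have bb : b * conjc b = a * conjc a by rewrite !normc_sqr E.
have -> : conjc (1 - b / a) = 1 - conjc b / conjc a.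
  by rewrite rmorphB rmorph1 rmorphM fmorphV.
have -> : (1 - b / a) * a = a - b by field.
rewrite mulrBl mul1r mulrAC [conjc b * b]mulrC bb mulfK //.
by ring.
Qed.

End RealLinearParts.

Lemma characterB (A : CBanachAlg) (chi : A -> C) : character chi ->
  forall x y, chi (x - y) = chi x - chi y.
Proof. by case=> lin _ _ _ x y; apply: functionalB. Qed.

Lemma character_invertible (A : CBanachAlg) (chi : A -> C) x :
  character chi -> invertible x -> chi x != 0.
Proof.
case=> [_ chiM chi1 _] [y [xy _]]; apply/eqP => x0.
have : chi 1 = 0 by rewrite -(xy : x * y = 1) chiM x0 mul0r.
by rewrite chi1 => /eqP; rewrite oner_eq0.
Qed.

Lemma open_subgroup_ball (A : CBanachAlg) (G : A -> Prop) :
  open_subgroup_of_units G ->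
  exists2 eps, 0 < eps & forall x : A, norm (x - 1) < eps -> G x.
Proof.
case=> [_ [G1 [_ [_ open]]]]; have [eps [/RltP eps0 H]] := open 1 G1.
by exists eps => // x /RltP; apply: H.
Qed.

(* Each character of [A] composed with [Psi] is [alpha eta + conj (k eta)] for a
   character [eta] of [B]; the isometry of [Psi] in both directions forces
   [alpha k = 0]. *)
Section CharacterComposition.
Variables (A B : CBanachAlg) (GB : B -> Prop) (eps : R).
Hypothesis G1 : GB 1.
Hypothesis GM : forall x y, GB x -> GB y -> GB (x * y).
Hypothesis GV : forall x y, GB x -> x * y = 1 -> y * x = 1 -> GB y.
Hypothesis eps0 : 0 < eps.
Hypothesis Gball : forall x, norm (x - 1) < eps -> GB x.
Variables (S : A -> B) (Psi : B -> A).
Hypothesis SP : real_linear_isometry S.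
Hypothesis PsiP : real_linear_isometry Psi.
Hypothesis SK : forall x, Psi (S x) = x.
Hypothesis Psi_inv : forall g, GB g -> invertible (Psi g).

Lemma character_twisted_mul (chi : A -> C) : character chi ->
  forall x y, chi (Psi (x * y)) * chi (Psi 1) = chi (Psi x) * chi (Psi y).
Proof.
move=> chiP; have [chilin _ chi1 chi_le] := chiP.
pose psi x := chi (Psi x).
have psiD x y : psi (x + y) = psi x + psi y.
  by rewrite /psi (rliD PsiP) functionalD.
have psiZ (r : R) x : psi (r%:C *: x) = r%:C * psi x.
  by rewrite /psi (rliZ PsiP) functionalZ.
pose L1 := linear_part psi; pose L2 := antilinear_part psi.
have L1lin : scalar L1 := linear_part_scalar psiD psiZ.
have L2lin : scalar L2 := antilinear_part_scalar psiD psiZ.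
have neq g : GB g -> normc (L1 g) != normc (L2 g).
  move=> Gg; apply: parts_norm_neq => // mu mu0.
  rewrite /psi; apply: (character_invertible chiP); apply: Psi_inv.
  exact: (scale_in_group G1 GM GV eps0 Gball).
have [eta etaP etaE] : exists2 eta : B -> C, character eta &
    forall x, L1 x = L1 1 * eta x /\ L2 x = L2 1 * eta x.
  (* Whichever part is larger at [1] yields the character. *)
  have := neq 1 G1; rewrite neq_lt => /orP[lt|lt].
    have neq' g : GB g -> normc (L2 g) != normc (L1 g) by move=> /neq; rewrite eq_sym.
    have [eta etaP E] := real_gleason_kahane_zelazko G1 GM eps0 Gball L2lin L1lin neq' lt.
    by exists eta => // x; have [] := E x.
  exact: (real_gleason_kahane_zelazko G1 GM eps0 Gball L1lin L2lin neq lt).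
set a := L1 1 in etaE; set k := L2 1 in etaE.
have psiE x : psi x = a * eta x + conjc (k * eta x).
  by have [<- <-] := etaE x; apply: parts_sum.
have [etalin etaM eta1 eta_le] := etaP.
have eta_scalar w : eta w%:A = w by rewrite functionalZ // eta1 mulr1.
have chi_scalar w : chi w%:A = w by rewrite functionalZ // chi1 mulr1.
pose M w := a * w + conjc (k * w).
have M_inj w : M w = 0 -> w = 0.
  move=> Mw; apply/eqP; apply: contraTT (neq 1 G1) => w0; rewrite negbK -/a -/k.
  have nw : normc w != 0 by rewrite normc_eq0.
  apply/eqP; apply: (mulIf nw); rewrite -!normcM -(normc_conj (k * w)).
  move/eqP: Mw; rewrite addr_eq0 => /eqP ->.
  by rewrite normcN.
have MB w v : M (w - v) = M w - M v.
  by rewrite /M !mulrBr rmorphB opprD addrACA.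
have M_le w : normc (M w) <= normc w.
  rewrite /M -{1 2}[w]eta_scalar -psiE /psi (le_trans (chi_le _)) //.
  by rewrite (rli_norm PsiP) normZ norm1 mulr1.
have M_ge w : normc w <= normc (M w).
  (* [S (M w)%:A] is the preimage of the scalar [M w] under [Psi]. Its image [v] under [eta] has
     modulus at most [|M w|] and satisfies [M v = M w], so injectivity of [M] gives [v = w]. *)
  pose v := eta (S (M w)%:A).
  have Mv : M v = M w by rewrite /M -psiE /psi SK chi_scalar.
  have -> : w = v.
    by apply/esym/eqP; rewrite -subr_eq0; apply/eqP/M_inj; rewrite MB Mv subrr.
  by rewrite Mv (le_trans (eta_le _)) // (rli_norm SP) normZ norm1 mulr1.
have /eqP : a * k = 0.
  by apply: isometric_real_linear_plane => w; apply/eqP; rewrite eq_le M_le M_ge.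
move=> ak x y; rewrite -![chi (Psi _)]/(psi _) !psiE etaM eta1 !mulr1.
move: ak; rewrite mulf_eq0 => /orP[/eqP->|/eqP->].
  by rewrite !mul0r !add0r !rmorphM /=; ring.
by rewrite !mul0r !rmorph0 !addr0; ring.
Qed.

End CharacterComposition.

Lemma iso_semisimple (A B : CBanachAlg) (Phi : A -> B) (Theta : B -> A) :
  (forall x, Theta (Phi x) = x) -> (forall y, Phi (Theta y) = y) ->
  (forall x y, Phi (x + y) = Phi x + Phi y) ->
  (forall x y, Phi (x * y) = Phi x * Phi y) -> Phi 1 = 1 ->
  semisimple A -> semisimple B.
Proof.
move=> PhiK ThetaK PhiD PhiM Phi1 ss y rad.
have Phi0 : Phi 0 = 0.
  by apply: (addrI (Phi 0)); rewrite -PhiD !addr0.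
have ThetaD u v : Theta (u + v) = Theta u + Theta v.
  by rewrite -{1}(ThetaK u) -{1}(ThetaK v) -PhiD PhiK.
have ThetaM u v : Theta (u * v) = Theta u * Theta v.
  by rewrite -{1}(ThetaK u) -{1}(ThetaK v) -PhiM PhiK.
have Theta1 : Theta 1 = 1 by rewrite -Phi1 PhiK.
have Theta0 : Theta 0 = 0 by rewrite -Phi0 PhiK.
suff Theta_y : Theta y = 0 by rewrite -(ThetaK y) Theta_y.
apply: ss => I [[I0 [ID IM]] [I1 maxI]].
apply: (rad (fun z => I (Theta z))); split; last split.
- split; first by rewrite [Theta _]Theta0.
  split=> [u v Iu Iv|u v Iv]; first by rewrite [Theta _]ThetaD; apply: ID.
  by rewrite [Theta _]ThetaM; apply: IM.
- by rewrite [Theta _]Theta1.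
move=> J [J0 [JD JM]] IJ J1 z Jz.
apply: (maxI (fun x => J (Phi x))).
- split; first by rewrite [Phi _]Phi0.
  split=> [u v Ju Jv|u v Jv]; first by rewrite [Phi _]PhiD; apply: JD.
  by rewrite [Phi _]PhiM; apply: JM.
- by move=> x Ix; apply: IJ; rewrite PhiK.
- by rewrite [Phi _]Phi1.
by rewrite ThetaK.
Qed.

(** * Vanishing of the constant term *)

Section ConstantTerm.
Variables (A B : CBanachAlg) (GA : A -> Prop) (GB : B -> Prop).
Hypothesis hc : commutative A.
Hypothesis ss : semisimple A.
Hypothesis openA : open_subgroup_of_units GA.
Hypothesis openB : open_subgroup_of_units GB.
Variables (T : A -> B) (T' : B -> A) (S : A -> B) (u : B).
Hypothesis TG : forall f, GA f -> GB (T f).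
Hypothesis T'G : forall g, GB g -> GA (T' g).
Hypothesis T'K : forall g, GB g -> T (T' g) = g.
Hypothesis SP : real_linear_isometry S.
Hypothesis TE : forall f, GA f -> T f = S f + u.

Lemma constant_term_eq0 : u = 0.
Proof.
have [unitA [GA1 [GAM [GAV _]]]] := openA.
have [_ [GB1 [GBM [GBV _]]]] := openB.
have [epsA epsA0 ballA] := open_subgroup_ball openA.
have [epsB epsB0 ballB] := open_subgroup_ball openB.
have tC (t : R) : t != 0 -> t%:C != 0.
  by move=> t0; rewrite -normc_eq0 normc_real normr_eq0.
have scaleA := scale_in_group GA1 GAM GAV epsA0 ballA.
have scaleB := scale_in_group GB1 GBM GBV epsB0 ballB.
(* If [T f = t g] with [t = (1 - s)^-1], then [T ((1 - s) f) = (1 - s) (t g - u) + u = g + s u]. The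
   value [s = 1] would mean scaling by zero, so translation by [u] is done in two halves. *)
have shift (s : R) g : s != 1 -> GB g -> GB (g + s%:C *: u).
  move=> s1 Gg; have d0 : 1 - s != 0 by rewrite subr_eq0 eq_sym.
  pose t := (1 - s)^-1.
  have t0 : t != 0 by rewrite invr_eq0.
  have Gtg : GB (t%:C *: g) by apply: scaleB => //; apply: tC.
  have Gf := T'G Gtg; have Ef := TE Gf; rewrite T'K // in Ef.
  have Gtf : GA ((1 - s)%:C *: T' (t%:C *: g)) by apply: scaleA => //; apply: tC.
  have := TG Gtf; rewrite TE // (rliZ SP).
  have -> : S (T' (t%:C *: g)) = t%:C *: g - u by apply: (canRL (addrK u)); rewrite -Ef.
  rewrite scalerBr scalerA -rmorphM mulfV // rmorph1 scale1r.
  by rewrite rmorphB rmorph1 scalerBl scale1r opprB addrA subrK.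
have half_ne1 : 2^-1 != 1 :> R by apply/eqP; lra.
have shift1 g : GB g -> GB (g + u).
  move=> Gg; have := shift _ _ half_ne1 (shift _ _ half_ne1 Gg).
  by rewrite -addrA -scalerDl -rmorphD (_ : 2^-1 + 2^-1 = 1 :> R) ?rmorph1 ?scale1r //; lra.
have [a aE] : exists a, S a = u by case: SP => _ _ _; apply.
have GAa f : GA f -> GA (f + a).
  move=> Gf; have G1 := shift1 _ (TG Gf); have Gf' := T'G G1.
  have := TE Gf'; rewrite T'K // => /addIr E.
  rewrite (_ : f + a = T' (T f + u)) //.
  by apply: (rli_inj SP); rewrite -E (rliD SP) aE -(TE Gf).
have GAga f g : GA f -> GA g -> GA (f + g * a).
  move=> Gf Gg; have [g' [gg' g'g]] := unitA g Gg.
  have Gg' := GAV g g' Gg gg' g'g.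
  have -> : f + g * a = g * (g' * f + a).
    by rewrite mulrDr mulrA (gg' : g * g' = 1) mul1r.
  exact: (GAM _ _ Gg (GAa _ (GAM _ _ Gg' Gf))).
(* Translation by [g a] is available for [g] in the group only, so [b] is split as [- l + (l + b)]
   with [l] large enough to put [l + b] in the cone. *)
have GAba b : GA (1 + b * a).
  pose l : R := (norm b + 1) / epsA.
  have l0 : 0 < l by rewrite divr_gt0 // ltr_wpDl ?norm_ge0r.
  have Glb : GA (l%:C%:A + b).
    apply: (near_scalar_in_group GA1 GAM GAV epsA0 ballA).
    by rewrite normc_real gtr0_norm // /l mulrC divfK ?gt_eqF // ltrDl.
  have Gl : GA (- l%:C)%:A.
    by apply: scaleA => //; rewrite oppr_eq0 tC // gt_eqF.
  have -> : 1 + b * a = (1 + (- l%:C)%:A * a) + (l%:C%:A + b) * a.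
    by rewrite -addrA -mulrDl addrA -scalerDl addNr scale0r add0r.
  exact: (GAga _ _ (GAga _ _ GA1 Gl) Glb).
suff a0 : a = 0 by rewrite -aE a0; apply: norm_eq0r; rewrite (rli_norm SP) norm0.
apply: (characters_separate hc ss epsA0 (fun y h => unitA y (ballA y h))) => chi chiP.
apply/eqP; apply/negPn/negP => ca.
have [chilin chiM chi1 _] := chiP.
have := character_invertible chiP (unitA _ (GAba ((- (chi a)^-1)%:A))).
by rewrite functionalD // chiM functionalZ // chi1 mulr1 mulNr mulVf // subrr eqxx.
Qed.

End ConstantTerm.

Theorem theorem3p2 (A B : CBanachAlg)
  (GA : A -> Prop) (GB : B -> Prop) (T : A -> B) :
  commutative A -> semisimple A ->
  open_subgroup_of_units GA -> open_subgroup_of_units GB ->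
  (forall f, GA f -> GB (T f)) ->
  (forall g, GB g -> exists f, GA f /\ T f = g) ->
  (forall f g, GA f -> GA g -> bdist (T f) (T g) = bdist f g) ->
  commutative B /\ semisimple B /\
  exists Phi : A -> B,
    isometric_real_algebra_iso A B Phi /\
    (* Phi extends f |-> T(1)^{-1} T(f), i.e. T(1) * Phi f = T f on GA *)
    (forall f, GA f -> mul (T one) (Phi f) = T f) /\
    (* in particular Phi restricts to an isometric group isomorphism A^{-1} -> B^{-1} *)
    (forall x, invertible x <-> invertible (Phi x)).
Proof.
move=> hc ss openA openB TG Tsurj Tdist.
have [unitA [GA1 [GAM [GAV _]]]] := openA.
have [unitB [GB1 [GBM [GBV _]]]] := openB.
have [epsA epsA0 ballA] := open_subgroup_ball openA.
have [epsB epsB0 ballB] := open_subgroup_ball openB.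
have Tiso f g : GA f -> GA g -> norm (T f - T g) = norm (f - g).
  exact: Tdist.
have exT' g : exists f, GB g -> GA f /\ T f = g.
  have [Gg|nGg] := pselect (GB g); last by exists 0.
  by have [f fP] := Tsurj g Gg; exists f.
have [T' T'P] := choice exT'.
have T'G g (Gg : GB g) : GA (T' g) by case: (T'P g Gg).
have T'K g (Gg : GB g) : T (T' g) = g by case: (T'P g Gg).
have TK f : GA f -> T' (T f) = f.
  move=> Gf; have GT := TG f Gf.
  apply/eqP; rewrite -subr_eq0; apply/eqP/norm_eq0r.
  by rewrite -Tiso ?T'K ?subrr ?norm0 //; apply: T'G.
have nbA f : GA f -> exists2 e, 0 < e & forall x : A, norm (x - f) < e -> GA x.
  by move=> Gf; apply: (group_open GAM epsA0 ballA Gf (unitA f Gf)).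
have nbB g : GB g -> exists2 e, 0 < e & forall y : B, norm (y - g) < e -> GB y.
  by move=> Gg; apply: (group_open GBM epsB0 ballB Gg (unitB g Gg)).
have Taff f : GA f -> exists S w, real_linear_isometry S /\ affine_near T S w f.
  move=> Gf; have [r r0 [S SP H]] := locally_affine nbA nbB TG T'G TK T'K Tiso Gf.
  exists S, (T f - S f); split=> //; exists r => // x xf.
  have := H _ xf; rewrite [f + _]addrC subrK => ->.
  by rewrite (rliB SP) addrCA.
have [S [u [SP TE]]] := globally_affine GA1 GAM GAV epsA0 ballA Tiso Taff.
have u0 := constant_term_eq0 hc ss openA openB TG T'G T'K SP TE.
have {}TE f : GA f -> T f = S f by move=> /TE; rewrite u0 addr0.
have exPsi y : exists x, S x = y by case: SP.
have [Psi PsiK] := choice exPsi.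
have SK x : Psi (S x) = x by apply: (rli_inj SP); rewrite PsiK.
have PsiP : real_linear_isometry Psi.
  split=> [x y|r x|x|y]; try by apply: (rli_inj SP); rewrite ?(rliD SP) ?(rliZ SP) !PsiK.
    by rewrite -(rli_norm SP) PsiK.
  by exists (S y).
have PsiG g : GB g -> GA (Psi g).
  by move=> Gg; rewrite -(T'K g Gg) TE ?SK; apply: T'G.
pose c := Psi 1.
have PsiM x y : Psi (x * y) * c = Psi x * Psi y.
  apply/eqP; rewrite -subr_eq0; apply/eqP.
  apply: (characters_separate hc ss epsA0 (fun y h => unitA y (ballA y h))) => chi chiP.
  rewrite (characterB chiP); have [_ chiM _ _] := chiP; rewrite !chiM.
  rewrite (character_twisted_mul GB1 GBM GBV epsB0 ballB SP PsiP SK) ?subrr //.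
  by move=> g /PsiG/unitA.
have [c' [cc' c'c]] := unitA c (PsiG 1 GB1).
have {}cc' : c * c' = 1 := cc'; have {}c'c : c' * c = 1 := c'c.
(* By [PsiM] the map [Theta] is multiplicative and unital; [Phi] is its inverse. *)
pose Phi a := S (c * a); pose Theta y := c' * Psi y.
have PhiK a : Theta (Phi a) = a by rewrite /Theta /Phi SK mulrA c'c mul1r.
have ThetaK y : Phi (Theta y) = y by rewrite /Theta /Phi mulrA cc' mul1r PsiK.
have PhiD x y : Phi (x + y) = Phi x + Phi y by rewrite /Phi mulrDr (rliD SP).
have comm (x y : A) : x * y = y * x := hc x y.
have PhiM x y : Phi (x * y) = Phi x * Phi y.
  have E : Psi (Phi x * Phi y) = c * x * (c * y) * c'.
    by rewrite -(SK (c * x)) -(SK (c * y)) -PsiM -mulrA cc' mulr1.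
  by rewrite -[RHS]PsiK E -mulrA (comm c y) -[y * c * c']mulrA cc' mulr1 -mulrA.
have Phi1 : Phi 1 = 1 by rewrite /Phi mulr1 PsiK.
have S1E a : S 1 * Phi a = S a.
  have -> : S 1 = Phi c' by rewrite /Phi cc'.
  by rewrite -PhiM /Phi mulrA cc' mul1r.
(* Both [c] and [S 1] have norm one, so submultiplicativity in [S (c a)] and in [S 1 * Phi a] gives
   the two inequalities. *)
have Phi_norm x : norm (Phi x) = norm x.
  apply/eqP; rewrite eq_le; apply/andP; split.
    rewrite /Phi (rli_norm SP) (le_trans (normM_le _ _)) //.
    by rewrite /c (rli_norm PsiP) norm1 mul1r.
  rewrite -[X in X <= _](rli_norm SP) -S1E (le_trans (normM_le _ _)) //.
  by rewrite (rli_norm SP) norm1 mul1r.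
split; last split.
- move=> x y; rewrite -[x]ThetaK -[y]ThetaK.
  by rewrite -[LHS]PhiM -[RHS]PhiM comm.
- exact: iso_semisimple PhiK ThetaK PhiD PhiM Phi1 ss.
exists Phi; split; last split.
- split=> //; split.
    by move=> r x; rewrite -[LHS]/(Phi (r%:C *: x)) /Phi -scalerAr (rliZ SP).
  split=> //; split; first exact: Phi_norm.
  split; last by move=> z; exists (Theta z).
  by move=> x y /(congr1 Theta); rewrite !PhiK.
- by move=> f Gf; rewrite (TE f Gf) -[RHS]S1E (TE 1 GA1).
move=> x; split=> [[y [xy yx]]|[y [xy yx]]].
  exists (Phi y); rewrite -[mul _ _]PhiM -[mul (Phi y) _]PhiM.
  by rewrite (xy : x * y = 1) (yx : y * x = 1) Phi1.
have E : Phi x * y = 1 by [].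
exists (Theta y).
have xT : x * Theta y = 1 by rewrite -[LHS]PhiK PhiM ThetaK E -Phi1 PhiK.
by split=> //; rewrite -[LHS]/(Theta y * x) comm.
Qed.
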